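(* There exists a deterministic algorithm which, given a prime $p$, positive integers $n,t,s$, and a set of matrices $\mathcal{S}=\{A_1,\dots,A_t\}\subseteq \mathrm{GL}(n,\mathbb{F}_p)$, decides whether the matrix algebra $\mathbb{F}_p[\mathcal{S}]$ is a finite field with extension degree $s$ over $\mathbb{F}_p$, and which performs at most $\mathcal{O}(t\,n^6\log(p))$ elementary operations in $\mathbb{F}_p$.
   Context: $\mathrm{Mat}_{\mathbb{F}_p}(n,n)$ is the ring of $n\times n$ matrices over the prime field $\mathbb{F}_p$, and $\mathrm{GL}(n,\mathbb{F}_p)$ is the group of invertible ones. For a non-empty set $\mathcal{S}\subseteq \mathrm{Mat}_{\mathbb{F}_p}(n,n)$, $\mathbb{F}_p[\mathcal{S}]=\mathbb{F}_p[A_1,\dots,A_t]$ denotes the $\mathbb{F}_p$-algebra generated by $\mathcal{S}$, i.e., the intersection of all subrings of $\mathrm{Mat}_{\mathbb{F}_p}(n,n)$ containing $\mathcal{S}$. Complexity is measured by the number of elementary field operations in $\mathbb{F}_p$ (additions, subtractions, multiplications, inversions, comparisons), and the constant in $\mathcal{O}$ is absolute (independent of $p,n,t,s$ and of the matrices). No oracle (e.g. for factoring $p^n-1$) is used. *)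

(* Defs.v *)
From HB Require Import structures.
From mathcomp Require Import all_boot all_order all_algebra.
From mathcomp Require Import reals exp.

Set Implicit Arguments.
Unset Strict Implicit.
Unset Printing Implicit Defensive.

Import Order.TTheory GRing.Theory Num.Theory.
Local Open Scope ring_scope.

(** * The machine model

    A RAM with two kinds of cells: integer cells (for indices, counters and
    flags) and field cells.  Cells are addressed by finite sequences of
    naturals, so that [:: k; i; j] reads as a multi-index.  Programs contain no
    field constants and do not depend on the field, so that one program runs
    over every 'F_p.  No instruction converts between integers and field
    elements, except the equality test of two field cells, which writes a flag.

    The integer part is limited to addition, truncated subtraction and halving,
    each charged: with free or multiplicative integer arithmetic it could serve
    as an oracle, for instance for factoring integers. *)

Inductive iexp : Type :=
| ICst of nat
| ICell of seq iexp
| IAdd of iexp & iexp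
| ISub of iexp & iexp
| IHalf of iexp.

Definition addr := seq iexp.

Inductive fexp : Type :=
| FZero
| FOne
| FCopy of addr
| FAdd of addr & addr
| FSub of addr & addr
| FMul of addr & addr
| FInv of addr.

Inductive cmd : Type :=
| Skip
| ISet of addr & iexp
| FSet of addr & fexp
| FTest of addr & addr & addr (* integer cell := (field cell == field cell) *)
| Seq of cmd & cmd
| If of iexp & cmd & cmd      (* a guard holds when its value is nonzero *)
| While of iexp & cmd.

Record state (F : fieldType) := State {
  icell : seq nat -> nat;
  fcell : seq nat -> F
}.

Definition upd (T : Type) (m : seq nat -> T) (a : seq nat) (x : T) :
    seq nat -> T :=
  fun b => if b == a then x else m b.

Fixpoint ieval (m : seq nat -> nat) (e : iexp) : nat :=
  match e with
  | ICst c => c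
  | ICell a => m (map (ieval m) a)
  | IAdd e1 e2 => (ieval m e1 + ieval m e2)%N
  | ISub e1 e2 => (ieval m e1 - ieval m e2)%N
  | IHalf e1 => (ieval m e1)./2
  end.

Section Semantics.

Variable F : fieldType.
Implicit Types (st : state F) (c : cmd) (a b : addr).

Definition loc st a : seq nat := map (ieval (icell st)) a.

Definition get st a : F := fcell st (loc st a).

(* FInv sends 0 to 0, following the library's convention. *)
Definition feval st (e : fexp) : F :=
  match e with
  | FZero => 0
  | FOne => 1
  | FCopy a => get st a
  | FAdd a b => get st a + get st b
  | FSub a b => get st a - get st b
  | FMul a b => get st a * get st b
  | FInv a => (get st a)^-1
  end.

Definition is_field_op (e : fexp) : bool :=
  match e with
  | FZero | FOne | FCopy _ => false
  | _ => true
  end.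

Definition iset st a (x : nat) : state F :=
  State (upd (icell st) (loc st a) x) (fcell st).

Definition fset st a (x : F) : state F :=
  State (icell st) (upd (fcell st) (loc st a) x).

(** [exec c st k m st']: from [st], the program [c] halts in [st'] after
    exactly [k] elementary field operations (additions, subtractions,
    multiplications, inversions, comparisons) and [m] bookkeeping steps
    (everything else: integer assignments, copies of field elements, loading of
    0 or 1, evaluations of a guard). *)
Inductive exec : cmd -> state F -> nat -> nat -> state F -> Prop :=
| ExecSkip st : exec Skip st 0 0 st
| ExecISet st a e : exec (ISet a e) st 0 1 (iset st a (ieval (icell st) e))
| ExecFSet st a e :
    exec (FSet a e) st (is_field_op e) (~~ is_field_op e)
         (fset st a (feval st e))
| ExecFTest st a b1 b2 :
    exec (FTest a b1 b2) st 1 0 (iset st a (get st b1 == get st b2))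
| ExecSeq c1 c2 st st1 st2 k1 k2 m1 m2 :
    exec c1 st k1 m1 st1 -> exec c2 st1 k2 m2 st2 ->
    exec (Seq c1 c2) st (k1 + k2) (m1 + m2) st2
| ExecIfT e c1 c2 st st1 k m :
    ieval (icell st) e != 0%N -> exec c1 st k m st1 ->
    exec (If e c1 c2) st k m.+1 st1
| ExecIfF e c1 c2 st st1 k m :
    ieval (icell st) e = 0%N -> exec c2 st k m st1 ->
    exec (If e c1 c2) st k m.+1 st1
| ExecWhileT e c st st1 st2 k1 k2 m1 m2 :
    ieval (icell st) e != 0%N ->
    exec c st k1 m1 st1 -> exec (While e c) st1 k2 m2 st2 ->
    exec (While e c) st (k1 + k2) (m1 + m2).+1 st2
| ExecWhileF e c st :
    ieval (icell st) e = 0%N -> exec (While e c) st 0 1 st.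

Lemma exec_deterministic c st k m st' k' m' st'' :
  exec c st k m st' -> exec c st k' m' st'' ->
  [/\ k = k', m = m' & st' = st''].
Proof.
move=> E; elim: E k' m' st'' => {c st k m st'}
  [st|st a e|st a e|st a b1 b2|c1 c2 st st1 st2 k1 k2 m1 m2 _ I1 _ I2
  |e c1 c2 st st1 k m h _ I1|e c1 c2 st st1 k m h _ I1
  |e c st st1 st2 k1 k2 m1 m2 h _ I1 _ I2|e c st h] k' m' st'' E;
  inversion E; subst => //.
- match goal with H : exec c1 _ _ _ _ |- _ => have [-> -> ?] := I1 _ _ _ H end.
  subst; match goal with H : exec c2 _ _ _ _ |- _ =>
    by have [-> -> ->] := I2 _ _ _ H end.
- match goal with H : exec c1 _ _ _ _ |- _ =>
    by have [-> -> ->] := I1 _ _ _ H end.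
- by move: h; match goal with H : ieval _ _ = _ |- _ => rewrite H end.
- by match goal with H : is_true (ieval _ _ != _) |- _ =>
    move: H; rewrite h end.
- match goal with H : exec c2 _ _ _ _ |- _ =>
    by have [-> -> ->] := I1 _ _ _ H end.
- match goal with H : exec c _ _ _ _ |- _ => have [-> -> ?] := I1 _ _ _ H end.
  subst; match goal with H : exec (While e c) _ _ _ _ |- _ =>
    by have [-> -> ->] := I2 _ _ _ H end.
- by move: h; match goal with H : ieval _ _ = _ |- _ => rewrite H end.
- by match goal with H : is_true (ieval _ _ != _) |- _ =>
    move: H; rewrite h end.
Qed.

End Semantics.

(** Integer cells [:: 0], [:: 1], [:: 2], [:: 3] hold p, n, t, s; the field
    cell [:: k; i; j] holds the (i, j) entry of the k-th matrix (all three
    indices counted from 0); every other cell holds 0. *)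
Definition input (p n t s : nat) (A : t.-tuple 'M['F_p]_n) : state 'F_p :=
  State
    (fun a => if a is [:: x] then nth 0%N [:: p; n; t; s] x else 0%N)
    (fun a => if a is [:: k; i; j] then
                match insub k, insub i, insub j with
                | Some k', Some i', Some j' => tnth A k' i' j'
                | _, _, _ => 0
                end
              else 0).

Definition accepting (F : fieldType) (st : state F) : bool :=
  icell st [::] != 0%N.

(** * The generated algebra *)

(* The intersection of all (unital) subrings containing S. *)
Definition gen_algebra (p n : nat) (S : {pred 'M['F_p]_n}) (M : 'M['F_p]_n) :
    Prop :=
  forall B : {pred 'M['F_p]_n},
    GRing.subring_closed B -> {subset S <= B} -> M \in B.

Definition is_field (p n : nat) (K : 'M['F_p]_n -> Prop) : Prop :=
  [/\ [/\ K 0, K 1%:M & (1%:M : 'M['F_p]_n) != 0],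
      forall M N, K M -> K N -> K (M - N) /\ K (M *m N),
      forall M N, K M -> K N -> M *m N = N *m M
    & forall M, K M -> M != 0 -> exists2 N, K N & M *m N = 1%:M].

Definition has_degree (p n : nat) (K : 'M['F_p]_n -> Prop) (s : nat) : Prop :=
  exists2 U : {vspace 'M['F_p]_n}, (forall M, M \in U <-> K M) & \dim U = s.

(* Main.v *)
(** Write K for the generated algebra and phi for the map x |-> x^p.  The program
    spins up an echelon basis of K over F_p, multiplying each basis element by
    each generator; K is commutative iff every commutator of a basis element
    with a generator vanishes.  For commutative K, phi is linear, and K is a
    field iff the kernel of phi^2 - phi is the line F_p.1.  In a field,
    phi (phi x - x) = 0 forces x^p = x, and x^p - x is the product of the x - c
    over c in F_p.  Conversely, every nonzero x in K has an idempotent power,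
    which lies in the kernel and so is 0 or 1: if it is 1, x is invertible; if
    it is 0, the last nonzero power of x has square 0, so it lies in the kernel
    without being a scalar.  By rank-nullity this is a condition on the rank of
    the images of the basis elements under phi^2 - phi.  The at most n^2
    basis elements yield t n^2 insertions of cost O(n^4) and n^2
    exponentiations of cost O(n^3 log p). *)

Require Import Defs.
From mathcomp Require Import all_boot all_order all_algebra.
From mathcomp Require Import reals exp.
From mathcomp Require Import zify finfield.

Set Implicit Arguments.
Unset Strict Implicit.
Unset Printing Implicit Defensive.

Import Order.TTheory GRing.Theory Num.Theory.
Local Open Scope ring_scope.

(** * Resource-bounded total correctness *)

Section TotalCorrectness.

Variable F : fieldType.
Implicit Types (st : state F) (c : cmd) (Q : state F -> Prop).

(** Total correctness: a halting run is part of the claim. One budget covers field operations and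
    bookkeeping together, so it bounds each of the two counts in the end. *)
Definition wp c (K : nat) Q st :=
  exists k m st', [/\ exec c st k m st', (k + m <= K)%N & Q st'].

Lemma wp_mono c K K' Q Q' st :
  wp c K Q st -> (K <= K')%N -> (forall st', Q st' -> Q' st') -> wp c K' Q' st.
Proof.
move=> [k [m [st' [E le_km q]]]] leK qq'; exists k, m, st'; split=> //.
  exact: leq_trans leK.
exact: qq'.
Qed.

Lemma wp_le K c K' Q st : wp c K Q st -> (K <= K')%N -> wp c K' Q st.
Proof. by move=> h le_K; apply: wp_mono h le_K _. Qed.

Lemma wp_skip Q st : Q st -> wp Skip 0 Q st.
Proof. by move=> q; exists 0%N, 0%N, st; split => //; apply: ExecSkip. Qed.

Lemma wp_iset a e Q st :
  Q (iset st a (ieval (icell st) e)) -> wp (ISet a e) 1 Q st.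
Proof. by move=> q; exists 0%N, 1%N; eexists; split; first exact: ExecISet. Qed.

Lemma wp_fset a e Q st : Q (fset st a (feval st e)) -> wp (FSet a e) 1 Q st.
Proof.
move=> q; do 3!eexists; split; first exact: ExecFSet; last by [].
by case: (is_field_op e).
Qed.

Lemma wp_ftest a b1 b2 Q st :
  Q (iset st a (get st b1 == get st b2)) -> wp (FTest a b1 b2) 1 Q st.
Proof. by move=> q; exists 1%N, 0%N; eexists; split; first exact: ExecFTest. Qed.

Lemma wp_seq c1 c2 K1 K2 Q st :
  wp c1 K1 (wp c2 K2 Q) st -> wp (Seq c1 c2) (K1 + K2) Q st.
Proof.
move=> [k1 [m1 [st1 [E1 le1 [k2 [m2 [st2 [E2 le2 q]]]]]]]].
exists (k1 + k2)%N, (m1 + m2)%N, st2; split=> //; first exact: ExecSeq E1 E2.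
by rewrite addnACA leq_add.
Qed.

Lemma wp_if e c1 c2 K Q st :
  (ieval (icell st) e != 0%N -> wp c1 K Q st) ->
  (ieval (icell st) e = 0%N -> wp c2 K Q st) ->
  wp (If e c1 c2) K.+1 Q st.
Proof.
move=> H1 H2; case: (eqVneq (ieval (icell st) e) 0%N) => he.
  have [k [m [st' [E le q]]]] := H2 he.
  by exists k, m.+1, st'; split; rewrite ?addnS //; apply: ExecIfF.
have [k [m [st' [E le q]]]] := H1 he.
by exists k, m.+1, st'; split; rewrite ?addnS //; apply: ExecIfT.
Qed.

(** The index of [I] counts completed iterations, and [N - i] is the variant. Each iteration pays
    one step for its guard; the last, failing guard gives the final successor. *)
Lemma wp_while (I : nat -> state F -> Prop) e c N Kb Q st :
  (forall i st', I i st' -> ieval (icell st') e = 0%N -> Q st') ->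
  (forall i st', I i st' -> ieval (icell st') e != 0%N ->
     (i < N)%N /\ wp c Kb (I i.+1) st') ->
  I 0%N st -> wp (While e c) (N * Kb.+1).+1 Q st.
Proof.
move=> hQ hc.
suff main r i st' : (N - i = r)%N -> I i st' -> wp (While e c) (r * Kb.+1).+1 Q st'.
  by apply: main; rewrite subn0.
elim: r i st' => [|r IH] i st' def_r hi.
all: case: (eqVneq (ieval (icell st') e) 0%N) => he.
- exists 0%N, 1%N, st'; split=> //; [exact: ExecWhileF | exact: hQ hi he].
- by case: (hc _ _ hi he); lia.
- exists 0%N, 1%N, st'; split=> //; [exact: ExecWhileF | exact: hQ hi he].
have [lt_iN [k1 [m1 [st1 [E1 le1 i1]]]]] := hc _ _ hi he.
have [|k2 [m2 [st2 [E2 le2 q]]]] := IH i.+1 st1 _ i1; first lia.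
exists (k1 + k2)%N, (m1 + m2).+1, st2; split=> //; last by rewrite mulSn; lia.
exact: ExecWhileT he E1 E2.
Qed.

Definition ivar (v : nat) : iexp := ICell [:: ICst v].

Definition For v (e : iexp) c :=
  Seq (ISet [:: ICst v] (ICst 0))
      (While (ISub e (ivar v))
             (Seq c (ISet [:: ICst v] (IAdd (ivar v) (ICst 1))))).

Lemma wp_for (I : nat -> state F -> Prop) v e c N Kb st :
  (forall i st', I i st' -> icell st' [:: v] = i /\ ieval (icell st') e = N) ->
  I 0%N (iset st [:: ICst v] 0) ->
  (forall i st', (i < N)%N -> I i st' ->
     wp c Kb (fun st'' => icell st'' [:: v] = i /\
                          I i.+1 (iset st'' [:: ICst v] i.+1)) st') ->
  wp (For v e c) (N * (Kb + 2) + 2) (I N) st.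
Proof.
move=> hI h0 hc.
apply: (@wp_mono _ (1 + (N * (Kb + 1).+1).+1)%N _ (I N)) => //; last by lia.
apply/wp_seq/wp_iset.
apply: (@wp_while (fun i st' => I i st' /\ (i <= N)%N)); last by split.
  move=> i st' [hi le_iN] /=; have [-> ->] := hI _ _ hi => /eqP.
  by rewrite subn_eq0 => ge_iN; have /eqP -> : N == i by rewrite eqn_leq ge_iN.
move=> i st' [hi le_iN] /=; have [-> ->] := hI _ _ hi.
rewrite subn_eq0 -ltnNge => lt_iN; split=> //.
apply: wp_seq; apply: wp_mono (hc _ _ lt_iN hi) _ _ => // st1 [v1 hi1].
by apply: wp_iset; rewrite /= v1 addn1.
Qed.

Definition nvar := ivar 1.

Definition For2 v w c := For v nvar (For w nvar c).

(** The two counters are merged into the row-major rank [i * n + j], so that an invariant about the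
    positions already visited needs one index only. It has to survive arbitrary writes to the
    counters, since these are reset and incremented between two runs of the body. *)
Lemma wp_for2 n (I : nat -> state F -> Prop) (v w : nat) c Kb st :
  (0 < n)%N -> v != w ->
  (forall q st' x, I q st' -> [/\ icell st' [:: 1%N] = n,
     I q (iset st' [:: ICst v] x) & I q (iset st' [:: ICst w] x)]) ->
  I 0%N st ->
  (forall (i j : 'I_n) st', I (i * n + j)%N st' ->
     icell st' [:: v] = i -> icell st' [:: w] = j ->
     wp c Kb (fun st'' => [/\ I (i * n + j).+1 st'',
       icell st'' [:: v] = i & icell st'' [:: w] = j]) st') ->
  wp (For2 v w c) (n * n * (Kb + 8)) (I (n * n)%N) st.
Proof.
move=> n_gt0 neq_vw hI h0 hc.
have updv x st' : icell (iset st' [:: ICst v] x) [:: v] = x.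
  by rewrite /= /upd /= eqxx.
have updw x st' : icell (iset st' [:: ICst w] x) [:: w] = x.
  by rewrite /= /upd /= eqxx.
have updvw x st' : icell (iset st' [:: ICst w] x) [:: v] = icell st' [:: v].
  by rewrite /= /upd /= eqseq_cons (negPf neq_vw).
pose J i st' := I (i * n)%N st' /\ icell st' [:: v] = i.
apply: (@wp_mono _ (n * (n * (Kb + 2) + 2 + 2) + 2)%N _ (J n)).
- apply: wp_for => [i st' [hi vi]||i st' lt_in [hi vi]].
  + by split=> //=; case: (hI _ _ 0%N hi).
  + by split=> //; case: (hI _ _ 0%N h0).
  pose J' j st' := [/\ I (i * n + j)%N st', icell st' [:: v] = i &
                       icell st' [:: w] = j].
  apply: (@wp_mono _ (n * (Kb + 2) + 2)%N _ (J' n)) => //.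
  + apply: wp_for => [j st1 [hj vj wj]||j st1 lt_jn [hj vj wj]].
    * by split=> //=; case: (hI _ _ 0%N hj).
    * by split=> //; rewrite ?addn0 ?updvw //; case: (hI _ _ 0%N hi).
    apply: wp_mono (hc (Ordinal lt_in) (Ordinal lt_jn) _ hj vj wj) _ _ => //.
    move=> st2 [h2 v2 w2]; split=> //.
    by split; rewrite ?updvw // addnS; case: (hI _ _ j.+1 h2).
  move=> st1 [h1 v1 _]; split=> //; split=> //.
  by rewrite mulSn addnC; case: (hI _ _ i.+1 h1).
- by nia.
by move=> st' [].
Qed.

End TotalCorrectness.

(** * Entrywise matrix programs *)

(* Scratch cells hold the loop counters of the matrix operations; they are
   invisible in specifications. *)
Definition scratch (a : seq nat) := if a is [:: x] then (20 <= x)%N else false.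

Definition agree (m im : seq nat -> nat) := forall a, ~~ scratch a -> m a = im a.

(** Quantifying over all memories that agree with [im] makes the value stable while the scratch
    counters run. *)
Definition denotes im (e : iexp) x := forall m, agree m im -> ieval m e = x.

Definition locates im (U : addr) u :=
  forall m, agree m im -> map (ieval m) U = u.

(** Prefixes of different lengths yield addresses of different lengths. Hence matrices at distinct
    prefixes never overlap, even when one prefix extends the other. *)
Lemma inj_entry u u' (i j i' j' : nat) :
  (u ++ [:: i; j] == u' ++ [:: i'; j']) = [&& u == u', i == i' & j == j'].
Proof.
case: (eqVneq (size u) (size u')) => [eq_sz|neq_sz].
  by rewrite eqseq_cat //= !eqseq_cons andbT.
have -> : (u == u') = false by apply: contraNF neq_sz => /eqP->.
apply: contraNF neq_sz => /eqP/(congr1 size).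
by rewrite !size_cat /= !addn2 => -[->].
Qed.

Section MatrixPrograms.

Variables (F : fieldType) (n : nat).
Implicit Types (st : state F) (im : seq nat -> nat) (mm : seq nat -> 'M[F]_n).

(* Every address prefix [u] names a matrix [mm u], stored at the cells
   [u ++ [:: i; j]]; field cells with addresses of length 1 stay outside of [mm]. *)
Definition rep im mm st :=
  agree (icell st) im /\
  forall u (i j : 'I_n), fcell st (u ++ [:: i : nat; j : nat]) = mm u i j.

Lemma rep_scratch im mm st v x :
  rep im mm st -> (20 <= v)%N -> rep im mm (iset st [:: ICst v] x).
Proof.
move=> [ri rm] le_v; split=> // a sa; rewrite /= /upd ifN ?ri //.
by apply: contraNneq sa => ->.
Qed.

Lemma rep_iset im mm st a b x :
  rep im mm st -> locates im a b -> rep (upd im b x) mm (iset st a x).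
Proof.
move=> [ri rm] la; split=> // c sc; rewrite /= /upd /loc la //.
by case: eqP => // _; apply: ri.
Qed.

Lemma rep_fscalar im mm st v x :
  rep im mm st -> rep im mm (fset st [:: ICst v] x).
Proof.
move=> [ri rm]; split=> // u i j; rewrite /= /upd ifN ?rm //.
by apply/negP => /eqP/(congr1 size); rewrite size_cat /= addn2.
Qed.

Definition entry (U : addr) e1 e2 : addr := U ++ [:: e1; e2].

Lemma get_entry im mm st U u e1 e2 (i j : 'I_n) :
  rep im mm st -> locates im U u -> ieval (icell st) e1 = i ->
  ieval (icell st) e2 = j -> get st (entry U e1 e2) = mm u i j.
Proof.
move=> [ri rm] lU h1 h2.
by rewrite /get /loc /entry map_cat /= h1 h2 (lU _ ri) rm.
Qed.

Lemma get_var im mm st U u (v w : nat) (i j : 'I_n) :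
  rep im mm st -> locates im U u -> icell st [:: v] = i ->
  icell st [:: w] = j -> get st (entry U (ivar v) (ivar w)) = mm u i j.
Proof. by move=> r lU h1 h2; apply: (get_entry r lU). Qed.

(* The state of the destination of an entrywise operation that has already
   written the first [q] entries, in row-major order. *)
Definition partial q (M N : 'M[F]_n) : 'M[F]_n :=
  \matrix_(a, b) if (a * n + b < q)%N then N a b else M a b.

Lemma partial0 M N : partial 0 M N = M.
Proof. by apply/matrixP => a b; rewrite mxE. Qed.

Lemma rowmajor_lt (a b : 'I_n) : (a * n + b < n * n)%N.
Proof. by have := ltn_ord a; have := ltn_ord b; nia. Qed.

Lemma rowmajor_inj (a b i j : 'I_n) :
  (a * n + b == i * n + j)%N = (a == i) && (b == j).
Proof.
apply/eqP/andP => [h|[/eqP-> /eqP->] //].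
have := congr1 (divn^~ n) h; have := congr1 (modn^~ n) h.
have n_gt0 : (0 < n)%N by apply: leq_trans (ltn_ord a).
rewrite /= !modnMDl !divnMDl // !modn_small // !divn_small // !addn0.
by move=> e1 e2; split; apply/eqP/val_inj.
Qed.

Lemma partial_all M N : partial (n * n) M N = N.
Proof. by apply/matrixP => a b; rewrite mxE rowmajor_lt. Qed.

Lemma rep_entry im mm st D d e1 e2 (i j : 'I_n) M N :
  rep im (upd mm d (partial (i * n + j) M N)) st -> locates im D d ->
  ieval (icell st) e1 = i -> ieval (icell st) e2 = j ->
  rep im (upd mm d (partial (i * n + j).+1 M N))
      (fset st (entry D e1 e2) (N i j)).
Proof.
move=> [ri rm] lD h1 h2; split=> // u a b.
rewrite /= /upd /loc /entry map_cat /= h1 h2 (lD _ ri) inj_entry.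
case: (eqVneq u d) => [->|neq_u] /=; last by rewrite rm /upd (negPf neq_u).
rewrite mxE ltnS leq_eqVlt rowmajor_inj -!val_eqE /=.
case: eqP => [/val_inj->|_] /=; last by rewrite rm /upd eqxx mxE.
by case: eqP => [/val_inj->|_] //=; rewrite rm /upd eqxx mxE.
Qed.

Lemma rep_ext im mm mm' st : mm =1 mm' -> rep im mm st -> rep im mm' st.
Proof. by move=> e [ri rm]; split=> // u i j; rewrite rm e. Qed.

Definition Each (D : addr) pre (e : fexp) :=
  For2 20 21 (Seq pre (FSet (entry D (ivar 20) (ivar 21)) e)).

(* Field cell [:: 0] is left available for a constant [c] of the operation. *)
Lemma wp_each im mm st D d pre e N K c :
  (0 < n)%N -> im [:: 1%N] = n -> rep im mm st -> locates im D d ->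
  fcell st [:: 0%N] = c ->
  (forall (i j : 'I_n) st1,
     rep im (upd mm d (partial (i * n + j) (mm d) N)) st1 ->
     icell st1 [:: 20%N] = i -> icell st1 [:: 21%N] = j ->
     fcell st1 [:: 0%N] = c ->
     wp pre K (fun st2 =>
       [/\ rep im (upd mm d (partial (i * n + j) (mm d) N)) st2,
           icell st2 [:: 20%N] = i, icell st2 [:: 21%N] = j,
           fcell st2 [:: 0%N] = c & feval st2 e = N i j]) st1) ->
  wp (Each D pre e) (n * n * (K + 9)) (rep im (upd mm d N)) st.
Proof.
move=> n_gt0 im1 r lD sc hpre.
pose I q st1 := rep im (upd mm d (partial q (mm d) N)) st1 /\
                fcell st1 [:: 0%N] = c.
apply: (@wp_mono _ _ (n * n * (K + 1 + 8)) _ (I (n * n)%N)).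
- apply: wp_for2 => //.
  + move=> q st1 x [[ri rm] sc1]; split; first by rewrite ri.
    * by split=> //; apply: rep_scratch.
    * by split=> //; apply: rep_scratch.
  + split=> //; apply: rep_ext r => u; rewrite /upd partial0.
    by case: eqP => // ->.
  move=> i j st1 [r1 sc1] v20 v21; apply: wp_seq.
  apply: wp_mono (hpre _ _ _ r1 v20 v21 sc1) _ _ => // st2 [r2 w20 w21 sc2 ev].
  apply: wp_fset; rewrite ev; split=> //; split; first exact: rep_entry.
  rewrite /= /upd /entry /loc map_cat ifN //.
  by apply/negP => /eqP/(congr1 size); rewrite size_cat /= addn2.
- by rewrite -addnA.
by move=> st1 [r1 _]; apply: rep_ext r1 => u; rewrite /upd partial_all.
Qed.

Definition Copy D U := Each D Skip (FCopy (entry U (ivar 20) (ivar 21))).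

Definition MSub D U V :=
  Each D Skip
    (FSub (entry U (ivar 20) (ivar 21)) (entry V (ivar 20) (ivar 21))).

(** An entry not yet written still has its old value, so an entrywise operation may overwrite one of
    its own operands. *)
Lemma upd_partial mm d q N u (i j : 'I_n) :
  (q <= i * n + j)%N -> upd mm d (partial q (mm d) N) u i j = mm u i j.
Proof. by rewrite /upd; case: eqP => // -> le_q; rewrite mxE ltnNge le_q. Qed.

Lemma wp_copy im mm st D d U u :
  (0 < n)%N -> im [:: 1%N] = n -> rep im mm st ->
  locates im D d -> locates im U u ->
  wp (Copy D U) (n * n * 9) (rep im (upd mm d (mm u))) st.
Proof.
move=> n_gt0 im1 r lD lU; apply: (@wp_each _ _ _ _ _ _ _ _ 0) => // i j st1.
move=> r1 v20 v21 sc1; apply: wp_skip; split=> //=.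
by rewrite (get_var r1 lU v20 v21) upd_partial.
Qed.

Lemma wp_msub im mm st D d U u V v :
  (0 < n)%N -> im [:: 1%N] = n -> rep im mm st ->
  locates im D d -> locates im U u -> locates im V v ->
  wp (MSub D U V) (n * n * 9) (rep im (upd mm d (mm u - mm v))) st.
Proof.
move=> n_gt0 im1 r lD lU lV; apply: (@wp_each _ _ _ _ _ _ _ _ 0) => // i j st1.
move=> r1 v20 v21 sc1; apply: wp_skip; split=> //=.
by rewrite (get_var r1 lU v20 v21) (get_var r1 lV v20 v21) !upd_partial // !mxE.
Qed.

(** The guard adds both truncated differences of the counters; it vanishes exactly on the
    diagonal. *)
Definition Ident D :=
  Each D
    (If (IAdd (ISub (ivar 20) (ivar 21)) (ISub (ivar 21) (ivar 20)))
        (FSet [:: ICst 1] FZero) (FSet [:: ICst 1] FOne))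
    (FCopy [:: ICst 1]).

Lemma wp_ident im mm st D d :
  (0 < n)%N -> im [:: 1%N] = n -> rep im mm st -> locates im D d ->
  wp (Ident D) (n * n * 11) (rep im (upd mm d 1%:M)) st.
Proof.
move=> n_gt0 im1 r lD; apply: (@wp_each _ _ _ _ _ _ _ _ 2) => // i j st1.
move=> r1 v20 v21 sc1.
have eq_ij : (i - j + (j - i) == 0)%N = (i == j).
  by rewrite -(inj_eq val_inj) /= addn_eq0 !subn_eq0 eqn_leq.
apply: wp_if; rewrite /= v20 v21 => h; apply: wp_fset.
  split=> //; first exact: rep_fscalar.
  by rewrite /= /get /= /upd /= mxE -eq_ij (negPf h).
split=> //; first exact: rep_fscalar.
by rewrite /= /get /= /upd /= mxE -eq_ij h.
Qed.

(** The factor is computed once and kept in cell [[:: 0]], because the loop overwrites the pivot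
    entry of [X] on its way. *)
Definition Elim X Y e1 e2 :=
  Seq (FSet [:: ICst 0] (FInv (entry Y e1 e2)))
 (Seq (FSet [:: ICst 0] (FMul (entry X e1 e2) [:: ICst 0]))
   (Each X
     (FSet [:: ICst 1] (FMul [:: ICst 0] (entry Y (ivar 20) (ivar 21))))
     (FSub (entry X (ivar 20) (ivar 21)) [:: ICst 1]))).

Lemma wp_elim im mm st X x Y y e1 e2 (i j : 'I_n) :
  (0 < n)%N -> im [:: 1%N] = n -> rep im mm st ->
  locates im X x -> locates im Y y -> x != y ->
  denotes im e1 i -> denotes im e2 j ->
  wp (Elim X Y e1 e2) (n * n * 12)
     (rep im (upd mm x (mm x - (mm x i j / mm y i j) *: mm y))) st.
Proof.
move=> n_gt0 im1 r lX lY neq_xy d1 d2.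
apply: (@wp_le _ (1 + (1 + n * n * (1 + 9)))); last by nia.
apply/wp_seq/wp_fset/wp_seq/wp_fset.
set st1 := fset st _ _; set st2 := fset st1 _ _.
have r1 : rep im mm st1 by apply: rep_fscalar.
have r2 : rep im mm st2 by apply: rep_fscalar.
apply: (@wp_each _ _ _ _ _ _ _ _ _ (mm x i j / mm y i j)) => //.
  rewrite -(get_entry r1 lX (d1 _ r1.1) (d2 _ r1.1)).
  by rewrite -(get_entry r lY (d1 _ r.1) (d2 _ r.1)).
move=> a b st3 r3 v20 v21 sc3; apply: wp_fset.
set st4 := fset st3 _ _.
have r4 : rep im _ st4 := rep_fscalar _ _ r3.
split=> //; rewrite -[feval _ _]/(get st4 (entry X (ivar 20) (ivar 21)) -
  fcell st3 [:: 0%N] * get st3 (entry Y (ivar 20) (ivar 21))).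
rewrite (get_var r4 lX v20 v21) sc3 (get_var r3 lY v20 v21) !upd_partial //.
by rewrite !mxE.
Qed.

Definition MMul D U V :=
  Each D
    (Seq (FSet [:: ICst 1] FZero)
      (For 22 nvar
        (Seq (FSet [:: ICst 2] (FMul (entry U (ivar 20) (ivar 22))
                                     (entry V (ivar 22) (ivar 21))))
             (FSet [:: ICst 1] (FAdd [:: ICst 1] [:: ICst 2])))))
    (FCopy [:: ICst 1]).

(** An entry of a product reads a whole row and a whole column, so in contrast to the entrywise
    operations the destination must differ from both factors. *)
Lemma wp_mmul im mm st D d U u V v :
  (0 < n)%N -> im [:: 1%N] = n -> rep im mm st ->
  locates im D d -> locates im U u -> locates im V v -> d != u -> d != v ->
  wp (MMul D U V) (n * n * n * 16) (rep im (upd mm d (mm u *m mm v))) st.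
Proof.
move=> n_gt0 im1 r lD lU lV neq_du neq_dv.
apply: (@wp_le _ (n * n * (1 + (n * (1 + 1 + 2) + 2) + 9))); last by nia.
apply: (@wp_each _ _ _ _ _ _ _ _ _ (fcell st [:: 0%N])) => // i j st1.
move=> r1 v20 v21 sc1; apply/wp_seq/wp_fset.
pose mm1 := upd mm d (partial (i * n + j) (mm d) (mm u *m mm v)).
(* The summand is extended by 0 to all naturals, so that the accumulator can be a sum up to the loop
   counter. *)
pose f l := if insub l is Some l' then mm u i l' * mm v l' j else 0.
pose I l st2 := [/\ rep im mm1 st2, [/\ icell st2 [:: 20%N] = i,
  icell st2 [:: 21%N] = j & icell st2 [:: 22%N] = l],
  fcell st2 [:: 0%N] = fcell st [:: 0%N]
  & fcell st2 [:: 1%N] = \sum_(0 <= k < l) f k].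
apply: (@wp_mono _ _ (n * (1 + 1 + 2) + 2) _ (I n)) => //.
  apply: wp_for.
  - move=> l st2 [r2 [_ _ ->] _ _]; split=> //=.
    by rewrite (r2.1 [:: 1%N]).
  - split=> //=; first by apply/rep_scratch => //; apply: rep_fscalar.
    by rewrite /upd /= big_geq.
  move=> l st2 lt_ln [r2 [w20 w21 w22] sc2 acc].
  apply/wp_seq/wp_fset/wp_fset; split=> //; split=> //=.
    by apply/rep_scratch => //; do 2!apply: rep_fscalar.
  rewrite -[LHS]/(fcell st2 [:: 1%N] + get st2 (entry U (ivar 20) (ivar 22)) *
                                      get st2 (entry V (ivar 22) (ivar 21))).
  have w22' : icell st2 [:: 22%N] = Ordinal lt_ln by [].
  rewrite acc (get_var r2 lU w20 w22') (get_var r2 lV w22' w21).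
  rewrite big_nat_recr //= /f insubT /= /mm1 /upd.
  by rewrite eq_sym (negPf neq_du) eq_sym (negPf neq_dv).
move=> st2 [r2 [w20 w21 w22] sc2 acc]; split=> //=.
rewrite /get /= acc mxE big_mkord; apply: eq_bigr => k _.
by rewrite /f valK.
Qed.

End MatrixPrograms.

(** * Insertion into an echelon family *)

(** Used with [V] the span of the stored matrices: an elimination step changes the current matrix
    but not the joint span. *)
Lemma addv_line_sub (F : fieldType) (vT : vectType F) (V : {vspace vT}) x y c :
  y \in V -> (V + <[x - c *: y]> = V + <[x]>)%VS.
Proof.
move=> yV; have cyV : c *: y \in V by rewrite memvZ.
apply/eqP; rewrite eqEsubv !subv_add !addvSl /= -!memvE.
have cyS z : c *: y \in (V + <[z]>)%VS by rewrite (subvP (addvSl _ _)).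
have lineS z : z \in (V + <[z]>)%VS by rewrite (subvP (addvSr _ _)) ?memv_line.
by rewrite memvB //= -[X in X \in _](subrK (c *: y)) memvD.
Qed.

(** Head 3 keeps the temporaries apart from the families, whose prefixes have heads 0, 1, 2, and
    length two keeps them apart from the generators. *)
Definition temp r : addr := [:: ICst 3; ICst r].

Section Insertion.

Variables (F : fieldType) (n : nat).
Implicit Types (st : state F) (im : seq nat -> nat) (mm : seq nat -> 'M[F]_n).
Implicit Types (ls : seq 'M[F]_n).

Definition vanishes q (M : 'M[F]_n) :=
  forall i j : 'I_n, (i * n + j < q)%N -> M i j = 0.

(* Cell [:: b; 0] counts the matrices stored at [:: b; 0], [:: b; 1], ... and
   cell [:: b; i; j] is either 0 or k.+1, where k is the index of a stored
   matrix whose first nonzero entry is at (i, j). *)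
Definition echelon b im mm ls :=
  [/\ im [:: b; 0%N] = size ls,
      forall k, (k < size ls)%N -> mm [:: b; k] = nth 0 ls k,
      free ls,
      forall i j : 'I_n, im [:: b; i : nat; j : nat] != 0%N ->
        [/\ (im [:: b; i : nat; j : nat] <= size ls)%N,
            vanishes (i * n + j) (nth 0 ls (im [:: b; i : nat; j : nat]).-1)
          & nth 0 ls (im [:: b; i : nat; j : nat]).-1 i j != 0]
    & forall Z, Z \in <<ls>>%VS -> forall i j : 'I_n, vanishes (i * n + j) Z ->
        im [:: b; i : nat; j : nat] = 0%N -> Z i j = 0].

Lemma echelon_ext b im im' mm mm' ls :
  (forall u, (1 < size u)%N -> head 0%N u = b -> im' u = im u) ->
  (forall k, mm' [:: b; k] = mm [:: b; k]) ->
  echelon b im mm ls -> echelon b im' mm' ls.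
Proof.
move=> ei em [hc hm hf hs hz]; split; rewrite ?ei //.
- by move=> k lt_k; rewrite em hm.
- by move=> i j; rewrite ei //; apply: hs.
by move=> Z Zls i j; rewrite ei //; apply: hz.
Qed.

Lemma echelon_iset b im mm ls v x :
  echelon b im mm ls -> echelon b (upd im [:: v] x) mm ls.
Proof.
apply: echelon_ext => // -[|a [|c u]] // _ _.
by rewrite /upd eqseq_cons andbF.
Qed.

Lemma echelon_mset b im mm ls c k x :
  b != c -> echelon b im mm ls -> echelon b im (upd mm [:: c; k] x) ls.
Proof.
move=> neq_bc; apply: echelon_ext => // l.
by rewrite /upd eqseq_cons (negPf neq_bc).
Qed.

(** By the last clause of [echelon], no element of the span has its first nonzero entry at an empty
    slot; so [x] is outside the span and freeness persists. To restore that clause, write an element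
    of the new span as [y + c *: x], vanishing before an empty slot [(k, l)]. If [(k, l)] precedes
    [(i, j)], then [c *: x] vanishes up to there and the old clause applies to [y]. Otherwise [y]
    vanishes before [(i, j)], hence also at it, and the entry at [(i, j)] forces [c = 0]. *)
Lemma echelon_store b im mm ls (i j : 'I_n) x :
  echelon b im mm ls -> im [:: b; i : nat; j : nat] = 0%N ->
  vanishes (i * n + j) x -> x i j != 0 ->
  echelon b (upd (upd im [:: b; 0%N] (size ls).+1)
                 [:: b; i : nat; j : nat] (size ls).+1)
    (upd mm [:: b; size ls] x) (rcons ls x).
Proof.
move=> [hc hm hf hs hz] s0 vx nzx.
have xNls : x \notin <<ls>>%VS.
  by apply: contraNN nzx => xls; rewrite (hz _ xls _ _ vx s0).
set im2 := upd _ _ _.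
have cntE : im2 [:: b; 0%N] = (size ls).+1.
  by rewrite /im2 /upd !eqseq_cons /= !andbF eqxx.
have slotE (a c : 'I_n) : im2 [:: b; a : nat; c : nat] =
    if (a == i) && (c == j) then (size ls).+1 else im [:: b; a : nat; c : nat].
  by rewrite /im2 /upd !eqseq_cons /= !andbF eqxx !andbT.
split=> [|k|||].
- by rewrite cntE size_rcons.
- rewrite size_rcons ltnS leq_eqVlt nth_rcons /upd !eqseq_cons eqxx /= andbT.
  by case: eqP => [->|_] /=; [rewrite ltnn | move=> lt_k; rewrite lt_k hm].
- rewrite (perm_free (Y := x :: ls)) ?free_cons ?xNls //.
  by rewrite perm_rcons.
- move=> a c; rewrite slotE; case: ifP => [/andP[/eqP-> /eqP->] _|_].
    by rewrite size_rcons nth_rcons ltnn eqxx.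
  move=> nz0; have [] := hs _ _ nz0; case: (im _) nz0 => // k _ lt_k v nz.
  by rewrite size_rcons nth_rcons lt_k; split=> //; apply: leqW.
move=> Z; rewrite -cats1 span_cat span_seq1.
move=> /memv_addP [y yls [_ /vlineP [c ->] ->]] k l vZ.
rewrite slotE; case: ifP => // ne_kl kl0.
have [lt_kl|gt_kl] : (k * n + l < i * n + j)%N \/ (i * n + j < k * n + l)%N.
- by apply/orP; rewrite -neq_ltn rowmajor_inj ne_kl.
- have cx0 (a e : 'I_n) : (a * n + e <= k * n + l)%N -> (c *: x) a e = 0.
    by move=> le_kl; rewrite mxE vx ?mulr0 //; apply: leq_ltn_trans lt_kl.
  rewrite mxE cx0 // addr0; apply: (hz _ yls _ _ _ kl0) => a e lt_ae.
  by have := vZ a e lt_ae; rewrite mxE cx0 ?addr0 // ltnW.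
have y0 (a e : 'I_n) : (a * n + e < i * n + j)%N -> y a e = 0.
  move=> lt_ae; have := vZ a e (ltn_trans lt_ae gt_kl).
  by rewrite !mxE vx // mulr0 addr0.
have yij : y i j = 0 := hz _ yls _ _ y0 s0.
have := vZ i j gt_kl; rewrite !mxE yij add0r => /eqP.
rewrite mulf_eq0 (negPf nzx) orbF => /eqP c0.
rewrite c0 mul0r addr0; apply: (hz _ yls _ _ _ kl0) => a e lt_ae.
by have := vZ a e lt_ae; rewrite !mxE c0 mul0r addr0.
Qed.

(** Addresses of length one are treated separately: the parameters in cells 0 to 3 survive although
    their addresses may be headed by [b]. *)
Definition touched b (a : seq nat) : bool :=
  match a with
  | [:: x] => (x == 10)%N || (x == 11)%N
  | x :: _ => x == b
  | [::] => false
  end.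

Definition mtouched b (u : seq nat) : bool :=
  (u == [:: 3; 0]%N) || if u is [:: x; _] then x == b else false.

Definition frame b im mm im' mm' :=
  (forall a, ~~ touched b a -> im' a = im a) /\
  (forall u, ~~ mtouched b u -> mm' u = mm u).

Lemma frame_iset b im mm im' mm' a x :
  frame b im mm im' mm' -> touched b a -> frame b im mm (upd im' a x) mm'.
Proof.
move=> [fi fm] ta; split=> // c tc; rewrite /upd fi //.
by case: eqP tc => // ->; rewrite ta.
Qed.

Lemma frame_mset b im mm im' mm' u x :
  frame b im mm im' mm' -> mtouched b u -> frame b im mm im' (upd mm' u x).
Proof.
move=> [fi fm] ta; split=> // c tc; rewrite /upd fm //.
by case: eqP tc => // ->; rewrite ta.
Qed.

Definition slot b : addr := [:: ICst b; ivar 10; ivar 11].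
Definition counter b : addr := [:: ICst b; ICst 0].

(* If the slot of the leading entry is empty, [X] is stored there, and the
   elimination then clears [X], which ends the insertion.  So
   <<stored matrices>> + <[X]> is invariant. *)
Definition Insert b :=
  For2 10 11
    (Seq (FSet [:: ICst 1] FZero)
    (Seq (FTest [:: ICst 23] (entry (temp 0) (ivar 10) (ivar 11)) [:: ICst 1])
    (If (ivar 23) Skip
      (Seq (If (ICell (slot b)) Skip
             (Seq (Copy [:: ICst b; ICell (counter b)] (temp 0))
             (Seq (ISet (counter b) (IAdd (ICell (counter b)) (ICst 1)))
                  (ISet (slot b) (ICell (counter b))))))
           (Elim (temp 0) [:: ICst b; ISub (ICell (slot b)) (ICst 1)]
                 (ivar 10) (ivar 11)))))).

Definition inserting b im mm ls x q st := exists im' mm' ls' r,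
  [/\ rep im' mm' st, echelon b im' mm' ls', vanishes q (mm' [:: 3; 0]%N),
      (<<ls'>> + <[mm' [:: 3; 0]%N]> = <<ls>> + <[x]>)%VS
    & ls' = ls ++ r /\ frame b im mm im' mm'].

(** Each of the n^2 positions costs at most one copy and one elimination, of n^2 entries each. That
    [ls'] extends [ls] at its end matters to spinning, which indexes the family while it grows. *)
Lemma wp_insert (b : nat) im mm ls st :
  (0 < n)%N -> b != 3%N -> im [:: 1%N] = n -> rep im mm st -> echelon b im mm ls ->
  wp (Insert b) (n * n * n * n * 40) (fun st' => exists im' mm' ls' r,
    [/\ rep im' mm' st', echelon b im' mm' ls',
        (<<ls'>> = <<ls>> + <[mm [:: 3; 0]%N]>)%VS, ls' = ls ++ r
      & frame b im mm im' mm']) st.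
Proof.
move=> n_gt0 b3 im1 r h.
apply: (@wp_mono _ _ (n * n * ((1 + (1 + ((n * n * 9 + (1 + 1)).+1 + n * n * 12).+1)) + 8)) _
  (inserting b im mm ls (mm [:: 3; 0]%N) (n * n))).
- apply: wp_for2 => //.
  + move=> q st1 x [im' [mm' [ls' [r' [rp e v sp [pr fr]]]]]].
    split; first by rewrite rp.1 ?fr.1.
    * exists (upd im' [:: 10%N] x), mm', ls', r'; split=> //.
      - exact: rep_iset.
      - exact: echelon_iset.
      - by split=> //; apply: frame_iset.
    * exists (upd im' [:: 11%N] x), mm', ls', r'; split=> //.
      - exact: rep_iset.
      - exact: echelon_iset.
      - by split=> //; apply: frame_iset.
  + exists im, mm, ls, [::]; split=> //; rewrite cats0; split=> //.
  move=> i j st1 [im' [mm' [ls' [r' [rp e v sp [pr fr]]]]]] v10 v11.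
  have w10 : im' [:: 10%N] = i by rewrite -v10 rp.1.
  have w11 : im' [:: 11%N] = j by rewrite -v11 rp.1.
  have im'1 : im' [:: 1%N] = n by rewrite fr.1.
  have lX im2 : locates im2 (temp 0) [:: 3; 0]%N by [].
  apply/wp_seq/wp_fset/wp_seq/wp_ftest.
  set st2 := fset st1 _ _; set st3 := iset st2 _ _.
  have rp2 : rep im' mm' st2 := rep_fscalar _ _ rp.
  have rp3 : rep im' mm' st3 by apply: rep_scratch.
  have test : ieval (icell st3) (ivar 23) = (mm' [:: 3; 0]%N i j == 0).
    rewrite -[LHS]/(nat_of_bool (_ == _)) (get_var rp2 (lX im') v10 v11).
    by congr (nat_of_bool (_ == _)).
  clearbody st3; apply: wp_if; rewrite test => xij.
    apply: (wp_le (K := 0%N)) => //; apply: wp_skip.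
    split; rewrite ?rp3.1 //; exists im', mm', ls', r'; split=> // a c.
    rewrite ltnS leq_eqVlt rowmajor_inj => /orP[|/v //].
    by case/andP=> /eqP-> /eqP->; move: xij; rewrite eqb0 negbK => /eqP.
  have {test}xij : mm' [:: 3; 0]%N i j != 0 by move/eqP: xij; rewrite eqb0.
  apply: wp_seq.
  have slotE im2 : im2 [:: 10%N] = i -> im2 [:: 11%N] = j ->
      locates im2 (slot b) [:: b; i : nat; j : nat].
    by move=> h10 h11 m ag; rewrite /= !ag // h10 h11.
  (* In both branches the slot of [(i, j)] is occupied afterwards, so the elimination always has a
     pivot. *)
  apply: (@wp_mono _ _ (n * n * 9 + (1 + 1)).+1 _ (fun st4 =>
    exists im2 mm2 ls2 r2, [/\ rep im2 mm2 st4, echelon b im2 mm2 ls2,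
      mm2 [:: 3; 0]%N = mm' [:: 3; 0]%N,
      (<<ls2>> + <[mm' [:: 3; 0]%N]> = <<ls>> + <[mm [:: 3; 0]%N]>)%VS &
      [/\ ls2 = ls ++ r2, frame b im mm im2 mm2, im2 [:: 10%N] = i,
        im2 [:: 11%N] = j & im2 [:: b; i : nat; j : nat] != 0%N]])) => //.
    have sE : ieval (icell st3) (ICell (slot b)) = im' [:: b; i : nat; j : nat].
      by rewrite /= !rp3.1 // w10 w11.
    apply: wp_if; rewrite sE => s0.
      apply: (wp_le (K := 0%N)) => //; apply: wp_skip.
      by exists im', mm', ls', r'.
    have [cE _ _ _ _] := e.
    have lD : locates im' [:: ICst b; ICell (counter b)] [:: b; size ls'].
      by move=> m ag; rewrite /= ag // cE.
    apply: wp_seq; apply: wp_mono (wp_copy n_gt0 im'1 rp3 lD (lX im')) _ _ => // st4.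
    set mm2 := upd _ _ _ => rp4; apply/wp_seq/wp_iset.
    have cnt4 : icell st4 [:: b; 0%N] = size ls' by rewrite rp4.1 // cE.
    have rp5 := rep_iset (a := counter b) (b := [:: b; 0%N])
      (ieval (icell st4) (IAdd (ICell (counter b)) (ICst 1))) rp4 (fun m ag => erefl).
    set st5 := iset st4 _ _ in rp5 *; set im3 := upd _ _ _ in rp5.
    apply: wp_iset.
    have v5 : ieval (icell st5) (ICell (counter b)) = (size ls').+1.
      by rewrite /= /upd eqxx /= cnt4 addn1.
    have z10 : im3 [:: 10%N] = i by rewrite /im3 /upd eqseq_cons andbF.
    have z11 : im3 [:: 11%N] = j by rewrite /im3 /upd eqseq_cons andbF.
    have rp6 := rep_iset (ieval (icell st5) (ICell (counter b))) rp5
      (slotE im3 z10 z11).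
    rewrite v5 in rp6 *.
    move: rp6; rewrite /im3 /= cnt4 addn1; set im4 := upd _ _ _ => rp6.
    exists im4, mm2, (rcons ls' (mm' [:: 3; 0]%N)), (rcons r' (mm' [:: 3; 0]%N)).
    split=> //.
    - exact: echelon_store.
    - by rewrite /mm2 /upd eqseq_cons eq_sym (negPf b3).
    (* The matrix is now both stored and current, so its line occurs twice in the sum. *)
    - by rewrite -cats1 span_cat span_seq1 -addvA addvv.
    split=> //.
    - by rewrite pr rcons_cat.
    - apply: frame_mset; last by rewrite /mtouched /= eqxx orbT.
      by apply: frame_iset => /=; [apply: frame_iset => /= |].
    - by rewrite /im4 /upd !eqseq_cons !andbF.
    - by rewrite /im4 /upd !eqseq_cons !andbF.
    by rewrite /im4 /upd eqxx.
  move=> st4 [im2 [mm2 [ls2 [r2 [rp4 e2 xE sp2 [pr2 fr2 z10 z11 nz]]]]]].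
  have [_ vecs _ slots _] := e2; have [le_s vy nzy] := slots _ _ nz.
  set k := (im2 _).-1 in vy nzy.
  have lt_k : (k < size ls2)%N by rewrite /k; case: (im2 _) nz le_s.
  have lY : locates im2 [:: ICst b; ISub (ICell (slot b)) (ICst 1)] [:: b; k].
    move=> m ag; have := slotE _ z10 z11 m ag.
    by rewrite /= => ->; rewrite ag // subn1.
  have im21 : im2 [:: 1%N] = n by rewrite fr2.1.
  have neq_xy : [:: 3; 0]%N != [:: b; k] by rewrite eqseq_cons eq_sym (negPf b3).
  have d10 : denotes im2 (ivar 10) i by move=> m ag; rewrite /= ag.
  have d11 : denotes im2 (ivar 11) j by move=> m ag; rewrite /= ag.
  apply: wp_mono (wp_elim n_gt0 im21 rp4 (lX im2) lY neq_xy d10 d11) _ _ => // st5.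
  rewrite xE vecs //; set y := nth 0 ls2 k; set x := mm' _ => rp5.
  split; rewrite ?rp5.1 //.
  exists im2; eexists; exists ls2, r2; split; [exact: rp5 | | | | split => //].
  - exact: echelon_mset.
  (* The entry at the pivot cancels; at earlier positions both the current matrix and the stored one
     vanish already. *)
  - rewrite /upd eqxx => a c; rewrite ltnS leq_eqVlt rowmajor_inj => /orP[|lt_ac].
      by case/andP=> /eqP-> /eqP->; rewrite !mxE divfK ?subrr.
    by rewrite !mxE (v _ _ lt_ac) (vy _ _ lt_ac) mulr0 subr0.
  - by rewrite /upd eqxx addv_line_sub // memv_span ?mem_nth.
  by apply: frame_mset.
- by nia.
move=> st1 [im' [mm' [ls' [r' [rp e v sp [pr fr]]]]]].
exists im', mm', ls', r'; split=> //; rewrite -sp.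
have -> : mm' [:: 3; 0]%N = 0.
  by apply/matrixP => a c; rewrite mxE v // rowmajor_lt.
by rewrite addv0.
Qed.

End Insertion.

(** * Exponentiation *)

Section Powering.

Variables (F : fieldType) (n : nat).
Implicit Types (st : state F) (im : seq nat -> nat) (mm : seq nat -> 'M[F]_n).

(** Binary powering from the lowest bit, with exponent the characteristic, read from cell 0 and
    halved in cell 6. [temp 6] holds the repeated squares, and [temp 7] is a buffer because products
    cannot be formed in place. The inner guard is the parity of the exponent. *)
Definition Pow (D S : addr) :=
  Seq (Copy (temp 6) S)
 (Seq (Ident D)
 (Seq (ISet [:: ICst 6] (ivar 0))
   (While (ivar 6)
     (Seq (If (ISub (ivar 6) (IAdd (IHalf (ivar 6)) (IHalf (ivar 6))))
              (Seq (MMul (temp 7) D (temp 6)) (Copy D (temp 7)))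
              Skip)
     (Seq (MMul (temp 7) (temp 6) (temp 6))
     (Seq (Copy (temp 6) (temp 7))
          (ISet [:: ICst 6] (IHalf (ivar 6))))))))).

Lemma wp_pow im mm st D d S s N :
  (0 < n)%N -> im [:: 1%N] = n -> rep im mm st ->
  (forall im', locates im' D d) -> locates im S s ->
  d != [:: 3; 6]%N -> d != [:: 3; 7]%N -> (0 < N)%N ->
  (im [:: 0%N] < 2 ^ N)%N ->
  wp (Pow D S) (n * n * n * N * 80) (fun st' => exists im' mm',
    [/\ rep im' mm' st', mm' d = mm s ^+ im [:: 0%N],
        forall a, a != [:: 6%N] -> im' a = im a
      & forall u, u \notin [:: d; [:: 3; 6]%N; [:: 3; 7]%N] -> mm' u = mm u]) st.
Proof.
move=> n_gt0 im1 r lD lS d6 d7 N_gt0 lt_p; set x := mm s; set p := im [:: 0%N].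
apply: (@wp_le _ (n * n * 9 + (n * n * 11 + (1 + (N *
  ((n * n * n * 16 + n * n * 9).+1 +
   (n * n * n * 16 + (n * n * 9 + 1))).+1).+1)))); last by nia.
have l6 im' : locates im' (temp 6) [:: 3; 6]%N by [].
have l7 im' : locates im' (temp 7) [:: 3; 7]%N by [].
apply: wp_seq; apply: wp_mono (wp_copy n_gt0 im1 r (l6 _) lS) _ _ => // st1 r1.
apply: wp_seq; apply: wp_mono (wp_ident n_gt0 im1 r1 (lD _)) _ _ => // st2.
set mm2 := upd _ d _ => r2; apply/wp_seq/wp_iset.
(* With [e] the remaining exponent, [a + b * e] stays equal to the characteristic; the bound
   [2 ^ (N - i)] on [e] limits the number of rounds to [N]. *)
pose I i st' := exists im' mm' a b, [/\ rep im' mm' st',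
  [/\ mm' d = x ^+ a, mm' [:: 3; 6]%N = x ^+ b & (a + b * im' [:: 6%N] = p)%N],
  (im' [:: 6%N] < 2 ^ (N - i))%N, 
  forall c, c != [:: 6%N] -> im' c = im c
  & forall u, u \notin [:: d; [:: 3; 6]%N; [:: 3; 7]%N] -> mm' u = mm u].
apply: (wp_while (I := I)).
- move=> i st' [im' [mm' [a [b [r' [dE bE abE] lt_e fi fm]]]]] /= e0.
  exists im', mm'; split=> //.
  by rewrite dE -abE -(r'.1 [:: 6%N]) // e0 muln0 addn0.
- move=> i st' [im' [mm' [a [b [r' [dE bE abE] lt_e fi fm]]]]].
  rewrite /= (r'.1 [:: 6%N]) // => e0; set e := im' _ in abE lt_e e0.
  have lt_iN : (i < N)%N.
    by rewrite ltnNge; apply/negP; rewrite -subn_eq0 => /eqP iN;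
      move: lt_e; rewrite iN expn0 ltnS leqn0 (negPf e0).
  split=> //.
  have im'1 : im' [:: 1%N] = n by rewrite fi.
  have eE : e = (odd e + (e./2 + e./2))%N by rewrite addnn odd_double_half.
  apply: wp_seq.
  apply: (@wp_mono _ _ (n * n * n * 16 + n * n * 9).+1 _ (fun st3 =>
    exists mm3, [/\ rep im' mm3 st3, mm3 d = x ^+ (a + b * odd e),
      mm3 [:: 3; 6]%N = x ^+ b &
      forall u, u \notin [:: d; [:: 3; 6]%N; [:: 3; 7]%N] -> mm3 u = mm u])) => //.
    apply: wp_if; rewrite /= !(r'.1 [:: 6%N]) // -/e => he.
      have -> : odd e by case: (odd e) eE => //; lia.
      apply: wp_seq.
      apply: wp_mono (wp_mmul n_gt0 im'1 r' (l7 _) (lD _) (l6 _) _ _) _ _ => //.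
        by rewrite eq_sym.
      move=> st3 r3.
      apply: wp_mono (wp_copy n_gt0 im'1 r3 (lD _) (l7 _)) _ _ => // st4 r4.
      eexists; split; first exact: r4.
      - by rewrite /upd !eqxx dE bE muln1 exprD.
      - by rewrite /upd [_ == d]eq_sym (negPf d6).
      move=> u hu; rewrite -fm // /upd; move: hu; rewrite !inE !negb_or.
      by case/and3P=> /negPf-> _ /negPf->.
    have -> : odd e = false by case: (odd e) eE => //; lia.
    apply: (wp_le (K := 0%N)) => //; apply: wp_skip; exists mm'.
    by rewrite muln0 addn0.
  move=> st3 [mm3 [r3 dE3 bE3 fm3]].
  apply: wp_seq.
  apply: wp_mono (wp_mmul n_gt0 im'1 r3 (l7 _) (l6 _) (l6 _) _ _) _ _ => //.
  move=> st4 r4; apply: wp_seq.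
  apply: wp_mono (wp_copy n_gt0 im'1 r4 (l6 _) (l7 _)) _ _ => // st5 r5.
  apply: wp_iset.
  have := rep_iset (a := [:: ICst 6]) (b := [:: 6%N])
      (ieval (icell st5) (IHalf (ivar 6))) r5 (fun m ag => erefl).
  rewrite /= (r5.1 [:: 6%N]) // -/e => r6.
  (* These witnesses reflect that [e] is its lowest bit plus twice [e./2]. *)
  do 2 eexists; exists (a + b * odd e)%N, (b + b)%N; split; first exact: r6.
  - split; first by rewrite /upd (negPf d6) (negPf d7).
      by rewrite /upd !eqxx bE3 exprD.
    rewrite /upd eqxx -abE {3}eE; lia.
  - rewrite /upd eqxx; move: lt_e.
    rewrite -(subnSK lt_iN) expnS; lia.
  - by move=> c /negPf c6; rewrite /upd c6 fi // c6.
  move=> u hu; rewrite -fm3 // /upd; move: hu; rewrite !inE !negb_or.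
  by case/and3P=> _ /negPf-> /negPf->.
do 2 eexists; exists 0%N, 1%N; split; first exact: (rep_iset _ r2 (b := [:: 6%N])).
- split; first by rewrite /mm2 /upd eqxx.
    by rewrite /mm2 /upd [_ == d]eq_sym (negPf d6) eqxx.
  by rewrite /upd eqxx /= r2.1 // mul1n.
- by rewrite /upd eqxx /= r2.1 // subn0.
- by move=> c /negPf c6; rewrite /upd c6.
move=> u; rewrite !inE !negb_or => /and3P[/negPf ud /negPf u6 /negPf u7].
by rewrite /mm2 /upd ud u6.
Qed.

End Powering.

(** * The generated algebra and the Frobenius map *)

Lemma span_ind (F : fieldType) (vT : vectType F) (V : {vspace vT})
    (f : {linear vT -> vT}) (ls : seq vT) x :
  (forall y, y \in ls -> f y \in V) -> x \in <<ls>>%VS -> f x \in V.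
Proof.
elim: ls x => [|y ls IH] x h.
  by rewrite span_nil memv0 => /eqP->; rewrite linear0 mem0v.
rewrite span_cons => /memv_addP [_ /vlineP [c ->] [z zls ->]].
rewrite linearD linearZ memvD //; first by rewrite memvZ // h // mem_head.
by apply: IH zls => u uls; apply: h; rewrite inE uls orbT.
Qed.

Section GeneratedAlgebra.

Variables (p n : nat).
Implicit Types (S : {pred 'M['F_p]_n}) (x y z : 'M['F_p]_n).

Lemma gen_sub S x : x \in S -> gen_algebra S x.
Proof. by move=> xS B _; apply. Qed.

Lemma gen1 S : gen_algebra S 1%:M.
Proof. by move=> B [B1 _ _] _. Qed.

Lemma genB S x y : gen_algebra S x -> gen_algebra S y -> gen_algebra S (x - y).
Proof.
by move=> gx gy B rB sB; have [_ BB _] := rB; apply: BB; [apply: gx|apply: gy].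
Qed.

Lemma genM S x y : gen_algebra S x -> gen_algebra S y -> gen_algebra S (x *m y).
Proof.
by move=> gx gy B rB sB; have [_ _ BM] := rB; apply: BM; [apply: gx|apply: gy].
Qed.

Lemma gen0 S : gen_algebra S 0.
Proof. by rewrite -(subrr 1%:M); apply: genB; apply: gen1. Qed.

Lemma genD S x y : gen_algebra S x -> gen_algebra S y -> gen_algebra S (x + y).
Proof.
move=> gx gy; rewrite -[y]opprK -[- y]sub0r; apply: genB => //.
by apply: genB => //; apply: gen0.
Qed.

(** A scalar of the prime field is a multiple of 1, so scaling is repeated addition. This is why the
    generated ring is a subspace. *)
Lemma genZ S c x : gen_algebra S x -> gen_algebra S (c *: x).
Proof.
move=> gx; rewrite -[c]natr_Zp scaler_nat; elim: (val c) => [|k IH].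
  by rewrite mulr0n; apply: gen0.
by rewrite mulrS; apply: genD.
Qed.

Lemma gen_span S (ls : seq 'M['F_p]_n) x :
  (forall y, y \in ls -> gen_algebra S y) -> x \in <<ls>>%VS ->
  gen_algebra S x.
Proof.
elim: ls x => [|y ls IH] x h; first by rewrite span_nil memv0 => /eqP->; apply: gen0.
rewrite span_cons => /memv_addP [_ /vlineP [c ->] [z zls ->]].
apply: genD; first by apply/genZ/h; rewrite mem_head.
by apply: IH zls => u uls; apply: h; rewrite inE uls orbT.
Qed.

(** The matrices whose right multiplication preserves the span form a subring containing [S], hence
    containing the whole algebra. Applied to 1, which lies in the span, an element [x] of the
    algebra gives [x] itself. *)
Lemma gen_algebra_span S (ls : seq 'M['F_p]_n) :
  (forall x, x \in ls -> gen_algebra S x) -> 1%:M \in <<ls>>%VS ->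
  (forall x a, x \in ls -> a \in S -> x *m a \in <<ls>>%VS) ->
  forall x, x \in <<ls>>%VS <-> gen_algebra S x.
Proof.
move=> hls h1 hM x; split; first exact: gen_span.
(* There are finitely many matrices, so this stabiliser is a boolean predicate, as [gen_algebra]
   demands. *)
move=> gx; pose B := [pred y | [forall z, (z \in <<ls>>%VS) ==> (z *m y \in <<ls>>%VS)]].
have : x \in B.
  apply: gx => [|a aS]; last first.
    apply/forallP => z; apply/implyP => zls.
    apply: (span_ind (f := mulmxr a)) zls => y yls /=; exact: hM.
  split.
  - by apply/forallP => z; apply/implyP; rewrite mulmx1.
  - move=> y y' /forallP By /forallP By'; apply/forallP => z; apply/implyP => zls.
    by rewrite mulmxBr memvB // (implyP (By _), implyP (By' _)).
  move=> y y' /forallP By /forallP By'; apply/forallP => z; apply/implyP => zls.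
  by rewrite mulmxA (implyP (By' _)) // (implyP (By _)).
by move/forallP/(_ 1%:M)/implyP/(_ h1); rewrite mul1mx.
Qed.

(** The centraliser of [x] is a subring; it contains [S], hence the algebra. *)
Lemma gen_commute S :
  (forall x a, gen_algebra S x -> a \in S -> x *m a = a *m x) ->
  forall x y, gen_algebra S x -> gen_algebra S y -> x *m y = y *m x.
Proof.
move=> h x y gx gy; apply/eqP.
apply: (gy [pred y | x *m y == y *m x]) => [|a aS]; last by rewrite inE h.
split; rewrite ?inE ?mulmx1 ?mul1mx //.
- by move=> z z'; rewrite !inE mulmxBr mulmxBl => /eqP-> /eqP->.
by move=> z z'; rewrite !inE mulmxA => /eqP->; rewrite -!mulmxA => /eqP->.
Qed.

End GeneratedAlgebra.

(** * Recognising fields by the kernel of phi^2 - phi *)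

Section FrobeniusCriterion.

Variables (p m : nat).
Hypothesis p_pr : prime p.
Local Notation n := m.+1.
Local Notation M := 'M['F_p]_n.
Implicit Types (x y : M).

Definition frobdiff n (x : 'M['F_p]_n) : 'M['F_p]_n := (x ^+ p) ^+ p - x ^+ p.

Lemma pcharM : p \in [pchar M].
Proof. by rewrite pchar_lalg pchar_Fp. Qed.

Lemma expD_comm x y : GRing.comm x y -> (x + y) ^+ p = x ^+ p + y ^+ p.
Proof. by move=> cxy; have := pFrobenius_autD_comm pcharM cxy. Qed.

Lemma expB_comm x y : GRing.comm x y -> (x - y) ^+ p = x ^+ p - y ^+ p.
Proof. by move=> cxy; have := pFrobenius_autB_comm pcharM cxy. Qed.

Lemma expZ c x : (c *: x) ^+ p = c *: x ^+ p.
Proof. by rewrite exprZn -{2}[c]expf_card card_Fp. Qed.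

Lemma frobdiffD x y : GRing.comm x y -> frobdiff (x + y) = frobdiff x + frobdiff y.
Proof.
move=> cxy; have cp : GRing.comm (x ^+ p) (y ^+ p).
  by apply/commrX/commr_sym/commrX/commr_sym.
by rewrite /frobdiff expD_comm // expD_comm // opprD addrACA.
Qed.

Lemma frobdiffZ c x : frobdiff (c *: x) = c *: frobdiff x.
Proof. by rewrite /frobdiff !expZ scalerBr. Qed.

Variable U : {vspace M}.
Hypothesis U1 : 1 \in U.
Hypothesis UM : forall x y, x \in U -> y \in U -> x * y \in U.
Hypothesis UC : forall x y, x \in U -> y \in U -> x * y = y * x.

Lemma UX x k : x \in U -> x ^+ k \in U.
Proof. by move=> xU; elim: k => [|k IH]; rewrite ?exprS ?UM. Qed.

(** [frobdiff] is additive only on commuting matrices, so it is not a linear map on the full matrix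
    ring. A linear [f0] is chosen with the same values on the basis; the two agree on the
    commutative [U], and rank-nullity for [f0] on [U] gives the dimensions. *)
Lemma frobdiff_dim (ls : seq M) : basis_of U ls ->
  exists2 W : {vspace M}, (forall x, x \in W <-> x \in U /\ frobdiff x = 0) &
    (\dim W + \dim <<[seq frobdiff x | x <- ls]>>)%N = size ls.
Proof.
move=> bU; have [/eqP sU fls] := andP bU.
have [f0 hf] := linear_of_free ls [seq frobdiff x | x <- ls].
have {}hf : [seq f0 x | x <- ls] = [seq frobdiff x | x <- ls].
  by apply: hf; rewrite ?size_map.
have hf1 x : x \in ls -> f0 x = frobdiff x by move/eq_in_map: hf; apply.
have fE x : x \in U -> f0 x = frobdiff x.
  rewrite -sU; have : {subset ls <= U} by move=> y yls; rewrite -sU memv_span.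
  elim: (ls) x hf1 => [|y l IH] x h lU.
    rewrite span_nil memv0 => /eqP->; rewrite linear0.
    by rewrite /frobdiff !expr0n; case: (p) p_pr => //= *; rewrite expr0n subrr.
  rewrite span_cons => /memv_addP [_ /vlineP [c ->] [z zl ->]].
  have lU' : {subset l <= U} by move=> u ul; apply: lU; rewrite inE ul orbT.
  have zU : z \in U by apply: subvP zl; apply/span_subvP.
  rewrite linearD linearZ /= h ?mem_head // IH //; last first.
    by move=> u ul; apply: h; rewrite inE ul orbT.
  rewrite -frobdiffZ -frobdiffD //; apply: UC => //.
  by rewrite memvZ // lU ?mem_head.
exists (U :&: lker (linfun f0))%VS.
  move=> x; rewrite memv_cap memv_ker lfunE /=.
  by split=> [/andP[xU]|[xU]]; rewrite fE // => /eqP ? //; rewrite xU.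
have := limg_ker_dim (linfun f0) U; rewrite -{2}sU limg_span.
rewrite (eq_map (lfunE f0)) hf => ->.
by rewrite -sU; apply/eqP.
Qed.

Lemma frobdiff_scalar c : frobdiff (c *: 1 : M) = 0.
Proof. by rewrite frobdiffZ /frobdiff !expr1n subrr scaler0. Qed.

(** By the pigeonhole principle two powers of [x] coincide, so from some exponent on the powers are
    periodic. *)
Lemma idempotent_power x : exists2 k, (0 < k)%N & x ^+ k * x ^+ k = x ^+ k.
Proof.
have : ~~ injectiveb (fun i : 'I_#|{: M}|.+1 => x ^+ i.+1).
  apply/injectiveP => /leq_card; by rewrite card_ord ltnn.
case/injectivePn => i [j neq_ij eq_x].
wlog lt_ij : i j neq_ij eq_x / (i < j)%N.
  move=> IH; case: (ltngtP i j) => [lt|lt|/val_inj eq]; first exact: (IH i j).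
    by apply: (IH j i) => //; rewrite eq_sym.
  by rewrite eq eqxx in neq_ij.
pose r := (j - i)%N; have r_gt0 : (0 < r)%N by rewrite subn_gt0.
have per k : x ^+ (i.+1 + k * r) = x ^+ i.+1.
  elim: k => [|k IH]; first by rewrite addn0.
  rewrite mulSn addnCA exprD IH -exprD /r.
  by rewrite eq_x; congr (_ ^+ _); lia.
(* This exponent is a multiple of the period [r] and lies in the periodic range, so doubling it does
   not change the power. *)
exists (i.+1 * r)%N; first by rewrite muln_gt0.
have le_ir : (i.+1 <= i.+1 * r)%N by rewrite leq_pmulr.
rewrite -exprD -{1}(subnK le_ir) -addnA exprD.
by rewrite per -exprD subnK.
Qed.

Lemma unit_of_frobdiff :
  (forall x, x \in U -> frobdiff x = 0 -> x \in <[1 : M]>%VS) ->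
  forall x, x \in U -> x != 0 -> exists2 y, y \in U & x * y = 1.
Proof.
move=> hker x xU nz_x; have [k k_gt0 ee] := idempotent_power x.
set e := x ^+ k in ee; have eU : e \in U by apply: UX.
have eX j : (0 < j)%N -> e ^+ j = e.
  by case: j => // j _; elim: j => // j IH; rewrite exprS IH.
have pgt0 := prime_gt0 p_pr.
have /vlineP [c ec] : e \in <[1 : M]>%VS.
  by apply: hker => //; rewrite /frobdiff !eX // subrr.
(* The idempotent [e] is a scalar [c], and an idempotent scalar is 0 or 1. If it is 1, then
   [x ^+ k.-1] inverts [x]. *)
have : (c * c - c) *: (1 : M) == 0.
  rewrite scalerBl -scalerA subr_eq0 -ec; apply/eqP.
  by rewrite -{2}ee {2}ec -scalerAl mul1r.
rewrite scaler_eq0 oner_eq0 orbF -{3}[c]mulr1 -mulrBr mulf_eq0 subr_eq0.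
case/orP=> /eqP c_eq; rewrite c_eq ?scale0r ?scale1r in ec; last first.
  exists (x ^+ k.-1); first exact: UX.
  by rewrite -exprS prednK // -/e ec.
(* Remaining case: [x] is nilpotent. With [j.+1] the least exponent killing [x], the power [x ^+ j]
   is nonzero but its square and all higher powers vanish, since [j.+1 <= j * l] for [l > 1]. *)
have ex0 : exists k, x ^+ k == 0 by exists k; apply/eqP.
case: (ex_minnP ex0) => [[|j]]; first by rewrite expr0 oner_eq0.
move=> /eqP xj min_j; have j_gt0 : (0 < j)%N.
  by case: j xj {min_j} => // x1; rewrite -[x]expr1 x1 eqxx in nz_x.
have nz_y : x ^+ j != 0 by apply/negP => /min_j; rewrite ltnn.
have y2 l : (1 < l)%N -> (x ^+ j) ^+ l = 0.
  move=> lt1l; rewrite -exprM -(subnK (_ : j.+1 <= j * l)%N); last by nia.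
  by rewrite exprD xj mulr0.
have yp := y2 p (prime_gt1 p_pr).
have /vlineP [d yd] : x ^+ j \in <[1 : M]>%VS.
  apply: hker; first exact: UX.
  by rewrite /frobdiff yp expr0n gtn_eqF // subr0.
have /eqP := y2 2%N isT; rewrite expr2 {1}yd -scalerAl mul1r scaler_eq0.
rewrite (negPf nz_y) orbF => /eqP d0.
by rewrite yd d0 scale0r eqxx in nz_y.
Qed.

Lemma frobdiff_of_unit :
  (forall x, x \in U -> x != 0 -> exists2 y, y \in U & x * y = 1) ->
  forall x, x \in U -> frobdiff x = 0 -> x \in <[1 : M]>%VS.
Proof.
move=> hu x xU; have cx : GRing.comm (x ^+ p) x by apply/commr_sym/commrX.
(* By additivity [frobdiff x] is the p-th power of [x ^+ p - x]; without nilpotents, [x ^+ p = x]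
   follows. *)
rewrite /frobdiff -expB_comm // => nil.
have integral y z : y \in U -> y * z = 0 -> y != 0 -> z = 0.
  move=> yU yz nz_y; have [y' y'U yy'] := hu y yU nz_y.
  by rewrite -[z]mul1r -yy' (UC yU) // -mulrA yz mulr0.
have nilp y k : y \in U -> y ^+ k = 0 -> y = 0.
  move=> yU; elim: k => [/eqP|k IH]; first by rewrite expr0 oner_eq0.
  rewrite exprS => yk; case: (eqVneq y 0) => // nz_y; exact/IH/integral/nz_y.
have xp : x ^+ p - x = 0 by apply: nilp nil; rewrite memvB ?UX.
have : horner_mx x (\prod_c ('X - c%:P)) = 0.
  rewrite -finField_genPoly card_Fp // rmorphB rmorphXn /= horner_mx_X xp.
  by [].
rewrite rmorph_prod /=.
under eq_bigr => c _ do rewrite rmorphB /= horner_mx_X horner_mx_C.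
(* If [x] is not a scalar, no factor [x - c] vanishes, and cancelling these factors of [U] one by
   one shows that the product is nonzero. *)
apply: contra_eqT => xN1.
elim: (index_enum _) => [|c l IH]; first by rewrite big_nil oner_neq0.
rewrite big_cons; apply: contra_neq IH => h.
apply: integral h _; first by rewrite -scalemx1 memvB // memvZ.
rewrite subr_eq0 -scalemx1; apply: contraNneq xN1 => ->.
by apply/vlineP; exists c.
Qed.

End FrobeniusCriterion.

(** The kernel of phi^2 - phi contains the scalars, so it is their line iff its dimension is 1,
    which rank-nullity turns into the condition on [l1]. The span of [l2] is bounded from both
    sides: it contains the commutators of [ls] with [S], and it is zero if the algebra commutes with
    [S]. So [l2] is empty iff the algebra is commutative. *)
Lemma field_criterion p n s (S : {pred 'M['F_p]_n}) (ls l1 l2 : seq 'M['F_p]_n) :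
  prime p -> (0 < n)%N ->
  free ls -> (forall x, x \in ls -> gen_algebra S x) -> 1%:M \in <<ls>>%VS ->
  (forall x a, x \in ls -> a \in S -> x *m a \in <<ls>>%VS) ->
  free l1 -> <<l1>>%VS = <<[seq @frobdiff p n x | x <- ls]>>%VS ->
  free l2 -> (forall x a, x \in ls -> a \in S -> x *m a - a *m x \in <<l2>>%VS) ->
  ((forall x a, gen_algebra S x -> a \in S -> x *m a = a *m x) ->
     <<l2>>%VS = 0%VS) ->
  [/\ size ls = s, size l2 = 0%N & (size l1).+1 = size ls] <->
  is_field (gen_algebra S) /\ has_degree (gen_algebra S) s.
Proof.
move=> p_pr; case: n S ls l1 l2 => // m S ls l1 l2 _.
move=> fls gls ls1 lsM fl1 sl1 fl2 sl2 comm0.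
have genE := gen_algebra_span gls ls1 lsM.
have UM x y : x \in <<ls>>%VS -> y \in <<ls>>%VS -> x * y \in <<ls>>%VS.
  by move=> /genE gx /genE gy; apply/genE/genM.
have basis_ls : basis_of <<ls>>%VS ls by rewrite basisEfree fls subvv /= (eqP fls).
have dims : \dim <<ls>>%VS = size ls by apply/eqP.
have dim1 : \dim <<l1>>%VS = size l1 by apply/eqP.
have dim2 : \dim <<l2>>%VS = size l2 by apply/eqP.
have one_dim1 : \dim <[1 : 'M['F_p]_m.+1]>%VS = 1%N by rewrite dim_vline oner_neq0.
split=> [[sz sz2 sz1]|[[[_ _ _] _ mulC hinv] [U0 hU dU]]].
  have l2_0 : <<l2>>%VS = 0%VS by apply/eqP; rewrite -dimv_eq0 dim2 sz2.
  have comm x a : gen_algebra S x -> a \in S -> x *m a = a *m x.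
    move=> /genE xls aS; apply/eqP; rewrite -subr_eq0.
    (* The commutator with [a] is linear, so it vanishes on the algebra once it vanishes on the
       basis. *)
    have := @span_ind _ _ 0%VS (mulmxr a \- mulmx a) ls x.
    rewrite !memv0; apply=> // y yls; rewrite -l2_0; exact: sl2.
  have UC x y : x \in <<ls>>%VS -> y \in <<ls>>%VS -> x * y = y * x.
    by move=> /genE gx /genE gy; apply: gen_commute gy.
  have [W hW dW] := frobdiff_dim p_pr UC basis_ls.
  have W1 : W = <[1 : 'M['F_p]_m.+1]>%VS.
    apply/esym/eqP; rewrite eqEdim -memvE one_dim1; apply/andP; split.
      by apply/hW; split=> //; rewrite -[1]scale1r frobdiff_scalar.
    by rewrite -sl1 dim1 -sz1 in dW; lia.
  split; last by exists <<ls>>%VS; [exact: genE | rewrite dims].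
  split.
  - by split; [apply: gen0 | apply: gen1 | apply: oner_neq0].
  - by move=> x y gx gy; split; [apply: genB | apply: genM].
  - by move=> x y gx gy; apply: gen_commute gy.
  move=> x /genE xls nz_x.
  have [|y /genE gy xy] := unit_of_frobdiff p_pr ls1 UM _ xls nz_x; last by exists y.
  by move=> z zls z0; rewrite -W1; apply/hW.
have UC x y : x \in <<ls>>%VS -> y \in <<ls>>%VS -> x * y = y * x.
  by move=> /genE gx /genE gy; apply: mulC.
have [W hW dW] := frobdiff_dim p_pr UC basis_ls.
have W1 : W = <[1 : 'M['F_p]_m.+1]>%VS.
  apply/eqP; rewrite eqEsubv -memvE; apply/andP; split; last first.
    by apply/hW; split=> //; rewrite -[1]scale1r frobdiff_scalar.
  apply/subvP => x /hW [xls x0]; apply: (frobdiff_of_unit p_pr ls1 UM UC) => //.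
  by move=> y /genE gy nz_y; have [z /genE zls yz] := hinv y gy nz_y; exists z.
split.
- rewrite -dims -dU; congr (\dim _); apply/vspaceP => x.
  by apply/idP/idP => [/genE/hU | /hU/genE].
- rewrite -dim2 comm0 ?dimv0 // => x a gx aS.
  by apply: mulC => //; apply: gen_sub.
by rewrite -dW W1 one_dim1 -sl1 dim1.
Qed.

(** * The decision program *)

(* Family 0 is a basis of the algebra, family 1 one of the image of phi^2 - phi,
   family 2 one of the span of the commutators. *)
Definition stored : addr := [:: ICst 0; ivar 7].

(** Cell 7 indexes the basis element and cell 8 the generator. [Insert] consumes [temp 0], so the
    product waits in [temp 1] while the commutator is inserted. *)
Definition SpinStep :=
  Seq (MMul (temp 1) stored [:: ivar 8])
 (Seq (MMul (temp 2) [:: ivar 8] stored)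
 (Seq (MSub (temp 0) (temp 1) (temp 2))
 (Seq (Insert 2)
 (Seq (Copy (temp 0) (temp 1))
      (Insert 0))))).

(** The bound is the current size of family 0, which may grow in the loop: new basis elements are
    processed in their turn, until the span is closed under right multiplication by the
    generators. *)
Definition Spin :=
  Seq (ISet [:: ICst 7] (ICst 0))
      (While (ISub (ICell (counter 0)) (ivar 7))
         (Seq (For 8 (ivar 2) SpinStep)
              (ISet [:: ICst 7] (IAdd (ivar 7) (ICst 1))))).

Definition FrobeniusStep :=
  Seq (Pow (temp 3) stored)
 (Seq (Pow (temp 4) (temp 3))
 (Seq (MSub (temp 0) (temp 4) (temp 3))
      (Insert 1))).

Definition dist e1 e2 := IAdd (ISub e1 e2) (ISub e2 e1).

(** A sum of naturals vanishes iff every term does, so a single guard tests all three conditions on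
    the sizes. The answer cell is 0 beforehand and stays so on rejection. *)
Definition Decide :=
  If (IAdd (dist (ICell (counter 0)) (ivar 3))
       (IAdd (ICell (counter 2))
             (dist (IAdd (ICell (counter 1)) (ICst 1)) (ICell (counter 0)))))
     Skip (ISet [::] (ICst 1)).

Definition Main :=
  Seq (Ident (temp 0))
 (Seq (Insert 0)
 (Seq Spin
 (Seq (For 7 (ICell (counter 0)) FrobeniusStep)
      Decide))).

(** * Correctness and cost of the decision program *)

Section Main.

Variables (p n t s : nat) (A : t.-tuple 'M['F_p]_n).
Hypothesis p_pr : prime p.
Hypothesis n_gt0 : (0 < n)%N.
Hypothesis t_gt0 : (0 < t)%N.
Implicit Types (im : seq nat -> nat) (mm : seq nat -> 'M['F_p]_n).
Implicit Types (Ls : nat -> seq 'M['F_p]_n) (st : state 'F_p).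
Local Notation gen := (gen_algebra (mem A)).
Local Notation frobdiff := (@frobdiff p n).

Definition valid im mm Ls :=
  [/\ [/\ im [:: 0] = p, im [:: 1] = n, im [:: 2] = t & im [:: 3] = s]%N,
      im [::] = 0%N, forall k : 'I_t, mm [:: k : nat] = tnth A k
    & forall b, (b < 3)%N -> echelon b im mm (Ls b)].

Lemma valid_iset im mm Ls v x :
  (3 < v)%N -> valid im mm Ls -> valid (upd im [:: v] x) mm Ls.
Proof.
move=> v3 [[i0 i1 i2 i3] i4 iA hE]; split=> // [|b b3].
  by rewrite /upd !eqseq_cons !andbT !ltn_eqF //; lia.
exact/echelon_iset/hE.
Qed.

Lemma valid_mset im mm Ls r x :
  valid im mm Ls -> valid im (upd mm [:: 3; r]%N x) Ls.
Proof.
move=> [i0 i4 iA hE]; split=> // [k|b b3].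
  by rewrite /upd eqseq_cons andbF.
by apply: echelon_mset (hE _ b3); rewrite ltn_eqF.
Qed.

Lemma valid_pow im im' mm mm' Ls r :
  (forall a, a != [:: 6%N] -> im' a = im a) ->
  (forall u, u \notin [:: [:: 3; r]; [:: 3; 6]; [:: 3; 7]]%N -> mm' u = mm u) ->
  valid im mm Ls -> valid im' mm' Ls.
Proof.
move=> fi fm [[i0 i1 i2 i3] i4 iA hE]; split; rewrite ?fi //.
  by move=> k; rewrite fm // !inE !eqseq_cons !andbF.
move=> b b3; apply: echelon_ext (hE _ b3).
  by move=> [|x [|y u]] // _ _; rewrite fi // eqseq_cons andbF.
by move=> k; rewrite fm // !inE !eqseq_cons ltn_eqF.
Qed.

Lemma wp_insert_valid b im mm Ls st :
  (b < 3)%N -> rep im mm st -> valid im mm Ls ->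
  wp (Insert b) (n * n * n * n * 40) (fun st' => exists im' mm' ls r,
    [/\ rep im' mm' st', valid im' mm' (fun c => if c == b then ls else Ls c),
        (<<ls>> = <<Ls b>> + <[mm [:: 3; 0]%N]>)%VS, ls = Ls b ++ r
      & frame b im mm im' mm']) st.
Proof.
move=> b3 r [[i0 i1 i2 i3] i4 iA hE].
have neq_b : b != 3%N by rewrite ltn_eqF.
apply: wp_mono (wp_insert n_gt0 neq_b i1 r (hE b b3)) _ _ => // st'.
move=> [im' [mm' [ls [r' [rp e sp pr fr]]]]]; exists im', mm', ls, r'.
have [fi fm] := fr; split=> //; split.
- by rewrite !fi.
- by rewrite fi.
- by move=> k; rewrite fm // /mtouched eqseq_cons andbF.
move=> c c3; case: eqP => [-> //|/eqP neq_cb].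
apply: echelon_ext (hE c c3) => [[|x [|y u]] //= _ ->|k].
  by rewrite fi //=; case: u.
by rewrite fm //= /mtouched !eqseq_cons ltn_eqF.
Qed.

(* The first [j] basis elements have been multiplied by all generators, the
   next one by the first [i] generators. *)
Definition spun j i (ls l2 : seq 'M['F_p]_n) :=
  [/\ forall x, x \in ls -> gen x, 1%:M \in <<ls>>%VS,
      forall k (a : 'I_t), (k < size ls)%N -> (k < j)%N || (k == j) && (a < i)%N ->
        nth 0 ls k *m tnth A a \in <<ls>>%VS /\
        nth 0 ls k *m tnth A a - tnth A a *m nth 0 ls k \in <<l2>>%VS
    & (forall x a, gen x -> a \in A -> x *m a = a *m x) -> <<l2>>%VS = 0%VS].

Lemma spun_next j ls l2 : spun j t ls l2 -> spun j.+1 0 ls l2.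
Proof.
move=> [h1 h2 h3 h4]; split=> // k a lt_k; rewrite andbF orbF ltnS => le_kj.
by apply: h3; rewrite // ltn_ord andbT orbC -leq_eqVlt.
Qed.

(** The pair [(j, i)] is the only new one. Earlier pairs keep their meaning because the family is
    extended at its end and both spans only increase. *)
Lemma spun_step j (i : 'I_t) ls l2 ls' l2' r :
  spun j i ls l2 -> (j < size ls)%N -> ls' = ls ++ r ->
  (<<ls'>> = <<ls>> + <[nth 0%R ls j *m tnth A i]>)%VS ->
  (<<l2'>> = <<l2>> +
     <[nth 0%R ls j *m tnth A i - tnth A i *m nth 0%R ls j]>)%VS ->
  spun j i.+1 ls' l2'.
Proof.
move=> [h1 h2 h3 h4] lt_j ls'E sp sp2.
have gj : gen (nth 0 ls j) by apply/h1/mem_nth.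
have gA : gen (tnth A i) by apply/gen_sub/mem_tnth.
have sub : (<<ls>> <= <<ls'>>)%VS by rewrite sp addvSl.
have sub2 : (<<l2>> <= <<l2'>>)%VS by rewrite sp2 addvSl.
split.
- move=> x /memv_span; rewrite sp => /memv_addP [y /(gen_span h1) gy].
  by move=> [_ /vlineP [c ->] ->]; apply/genD/genZ/genM.
- exact: subvP h2.
- move=> k a lt_k hk.
  have lt_k' : (k < size ls)%N by lia.
  rewrite ls'E nth_cat lt_k' -ls'E; move: hk.
  case: (eqVneq k j) => [->|neq_kj]; last first.
    rewrite /= orbF => lt_kj; have [] := h3 k a lt_k'; first by rewrite lt_kj.
    by move=> u1 u2; rewrite (subvP sub) // (subvP sub2).
  rewrite ltnn ltnS leq_eqVlt => /= /orP[/eqP a_i|lt_ai].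
    have {a_i}-> : a = i by apply: val_inj.
    by rewrite sp sp2 !(subvP (addvSr _ _)) ?memv_line.
  have [] := h3 j a lt_j; first by rewrite eqxx lt_ai orbT.
  by move=> u1 u2; rewrite (subvP sub) // (subvP sub2).
move=> hc; rewrite sp2 h4 // hc ?mem_tnth // subrr.
by rewrite addv0.
Qed.

Lemma stored_locates im j : im [:: 7%N] = j -> locates im stored [:: 0%N; j].
Proof. by move=> h m ag; rewrite /= ag // h. Qed.

Lemma wp_spin_step im mm Ls st j (i : 'I_t) :
  rep im mm st -> valid im mm Ls -> im [:: 7%N] = j -> im [:: 8%N] = i ->
  (j < size (Ls 0%N))%N -> spun j i (Ls 0%N) (Ls 2%N) ->
  wp SpinStep (n * n * n * n * 130) (fun st' => exists im' mm' Ls',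
    [/\ rep im' mm' st', valid im' mm' Ls', im' [:: 7%N] = j, im' [:: 8%N] = i &
        [/\ (size (Ls 0) <= size (Ls' 0))%N, spun j i.+1 (Ls' 0%N) (Ls' 2%N)
          & Ls' 1%N = Ls 1%N]]) st.
Proof.
move=> rp va v7 v8 lt_j spn.
apply: (@wp_le _ (n * n * n * 16 + (n * n * n * 16 + (n * n * 9 +
  (n * n * n * n * 40 + (n * n * 9 + n * n * n * n * 40)))))); last first.
  by have : (n * n <= n * n * n * n /\ n * n * n <= n * n * n * n)%N; [nia|lia].
have [[i0 i1 i2 i3] i4 iA hE] := va.
have [_ vecs _ _ _] := hE 0%N isT.
have lL : locates im stored [:: 0%N; j] by apply: stored_locates.
have lA : locates im [:: ivar 8] [:: i : nat] by move=> m ag; rewrite /= ag // v8.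
have lT im' r : locates im' (temp r) [:: 3; r]%N by [].
have nA r : [:: 3; r]%N != [:: i : nat] by rewrite eqseq_cons andbF.
set x := nth 0 (Ls 0%N) j.
apply: wp_seq.
apply: wp_mono (wp_mmul n_gt0 i1 rp (lT _ 1%N) lL lA isT (nA _)) _ _ => // st1.
rewrite vecs // iA -/x; set mm1 := upd _ _ _ => r1.
apply: wp_seq.
apply: wp_mono (wp_mmul n_gt0 i1 r1 (lT _ 2%N) lA lL (nA _) isT) _ _ => // st2.
have -> : mm1 [:: i : nat] = tnth A i by rewrite /mm1 /upd eqseq_cons andbF iA.
have -> : mm1 [:: 0%N; j] = x by rewrite /mm1 /upd /= vecs.
set mm2 := upd _ _ _ => r2.
apply: wp_seq.
apply: wp_mono (wp_msub n_gt0 i1 r2 (lT _ 0%N) (lT _ 1%N) (lT _ 2%N)) _ _ => // st3.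
rewrite -[mm2 [:: 3; 1]%N]/(x *m tnth A i) -[mm2 [:: 3; 2]%N]/(tnth A i *m x).
set mm3 := upd _ _ _ => r3.
have va3 : valid im mm3 Ls by do 3!apply: valid_mset.
apply: wp_seq.
apply: wp_mono (wp_insert_valid (b := 2) isT r3 va3) _ _ => // st4.
move=> [im4 [mm4 [l2 [r' [r4 va4 sp2 _ [fi4 fm4]]]]]].
have [[_ i41 _ _] _ _ _] := va4.
apply: wp_seq.
apply: wp_mono (wp_copy n_gt0 i41 r4 (lT _ 0%N) (lT _ 1%N)) _ _ => // st5.
rewrite fm4 // -[mm3 [:: 3; 1]%N]/(x *m tnth A i) => r5.
have va5 := valid_mset 0 (x *m tnth A i) va4.
apply: wp_mono (wp_insert_valid (b := 0) isT r5 va5) _ _ => // st6.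
move=> [im6 [mm6 [ls [r6 [rp6 va6 sp pr [fi6 fm6]]]]]].
exists im6, mm6; eexists; split; [exact: rp6 | exact: va6 | | | split] => //=.
- by rewrite fi6 // fi4.
- by rewrite fi6 // fi4.
- by rewrite pr size_cat leq_addr.
by apply: spun_step spn lt_j pr sp sp2.
Qed.

Lemma free_size_le (ls : seq 'M['F_p]_n) : free ls -> (size ls <= n * n)%N.
Proof.
move=> /eqP <-; apply: leq_trans (dimvS (subvf _)) _.
by rewrite dimvf /dim.
Qed.

(** Each outer iteration handles one member of a free family in a space of dimension n^2, which
    bounds the iterations by n^2 although the family may grow meanwhile. *)
Lemma wp_spin im mm Ls st :
  rep im mm st -> valid im mm Ls -> spun 0 0 (Ls 0%N) (Ls 2%N) ->
  Ls 1%N = [::] ->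
  wp Spin (n * n * t * (n * n * n * n) * 150) (fun st' => exists im' mm' Ls',
    [/\ rep im' mm' st', valid im' mm' Ls', Ls' 1%N = [::]
      & spun (size (Ls' 0%N)) 0 (Ls' 0%N) (Ls' 2%N)]) st.
Proof.
move=> rp va spn l1.
apply: (@wp_le _ (1 + (n * n * ((t * (n * n * n * n * 130 + 2) + 2) + 1).+1).+1));
  last first.
  have : (0 < n * n * n * n)%N by rewrite !muln_gt0 n_gt0.
  have : (0 < n * n)%N by rewrite muln_gt0 n_gt0.
  move: (n * n * n * n)%N => b; move: (n * n)%N => a a_gt0 b_gt0.
  have : (a * t <= a * t * b)%N by rewrite leq_pmulr.
  have : (a <= a * t)%N by rewrite leq_pmulr.
  lia.
pose I j st' := exists im' mm' Ls', [/\ rep im' mm' st', valid im' mm' Ls',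
  im' [:: 7%N] = j, Ls' 1%N = [::] & (j <= size (Ls' 0%N))%N /\
  spun j 0 (Ls' 0%N) (Ls' 2%N)].
apply/wp_seq/wp_iset; apply: (wp_while (I := I)).
- move=> j st' [im' [mm' [Ls' [r' va' v7 l1' [le_j sp]]]]] /=.
  have [_ _ _ /(_ 0%N isT) [cnt _ _ _ _]] := va'.
  rewrite !r'.1 // cnt v7 => /eqP; rewrite subn_eq0 => ge_j.
  have jE : j = size (Ls' 0%N) by apply/eqP; rewrite eqn_leq le_j.
  by exists im', mm', Ls'; rewrite -{1}jE.
- move=> j st' [im' [mm' [Ls' [r' va' v7 l1' [le_j sp]]]]] /=.
  have [[_ _ i2 _] _ _ /(_ 0%N isT) [cnt _ fr _ _]] := va'.
  rewrite !r'.1 // cnt v7 subn_eq0 -ltnNge => lt_j; split.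
    exact: leq_trans lt_j (free_size_le fr).
  pose J i st2 := exists im2 mm2 Ls2, [/\ rep im2 mm2 st2, valid im2 mm2 Ls2,
    im2 [:: 7%N] = j, im2 [:: 8%N] = i & [/\ (j < size (Ls2 0%N))%N,
    spun j i (Ls2 0%N) (Ls2 2%N) & Ls2 1%N = [::]]].
  apply: wp_seq.
  apply: (@wp_mono _ _ (t * (n * n * n * n * 130 + 2) + 2) _ (J t)) => //.
    apply: wp_for.
    + move=> i st2 [im2 [mm2 [Ls2 [r2 [[_ _ i22 _] _ _ _] _ v8 _]]]].
      by rewrite /= !r2.1.
    + exists (upd im' [:: 8%N] 0%N), mm', Ls'; split=> //.
        exact: rep_iset.
      exact: valid_iset.
    move=> i st2 lt_i [im2 [mm2 [Ls2 [r2 va2 w7 w8 [lt_j2 sp2 l12]]]]].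
    have := wp_spin_step (i := Ordinal lt_i) r2 va2 w7 w8 lt_j2 sp2.
    move=> h; apply: wp_mono h _ _ => // st3 [im3 [mm3 [Ls3]]].
    move=> [r3 va3 u7 u8 [le_s sp3 l13]]; split; first by rewrite r3.1.
    exists (upd im3 [:: 8%N] i.+1), mm3, Ls3; split=> //.
    + exact: rep_iset.
    + exact: valid_iset.
    split=> //; last by rewrite l13.
    exact: leq_trans le_s.
  move=> st2 [im2 [mm2 [Ls2 [r2 va2 w7 w8 [lt_j2 sp2 l12]]]]].
  apply: wp_iset; rewrite /= r2.1 // w7 addn1.
  exists (upd im2 [:: 7%N] j.+1), mm2, Ls2; split=> //.
  + exact: rep_iset.
  + exact: valid_iset.
  by split=> //; apply: spun_next.
exists (upd im [:: 7%N] 0%N), mm, Ls; split=> //.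
- exact: rep_iset.
exact: valid_iset.
Qed.

Lemma wp_frobenius_step im mm Ls st j N :
  (p < 2 ^ N)%N -> rep im mm st -> valid im mm Ls -> im [:: 7%N] = j ->
  (j < size (Ls 0%N))%N ->
  wp FrobeniusStep (n * n * n * n * N * 209) (fun st' => exists im' mm' l1,
    [/\ rep im' mm' st', valid im' mm' (fun c => if c == 1%N then l1 else Ls c),
        im' [:: 7%N] = j &
        (<<l1>> = <<Ls 1%N>> + <[frobdiff (nth 0%R (Ls 0%N) j)]>)%VS]) st.
Proof.
move=> lt_p rp va v7 lt_j.
have N_gt0 : (0 < N)%N.
  by case: N lt_p => // lt_p1; have := prime_gt0 p_pr; rewrite lt0n; case: p lt_p1.
apply: (@wp_le _ (n * n * n * N * 80 + (n * n * n * N * 80 + (n * n * 9 +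
  n * n * n * n * 40)))); last first.
  have : (n * n * n * N <= n * n * n * n * N)%N by rewrite leq_mul // leq_pmulr.
  have : (n * n <= n * n * n * n)%N by rewrite -mulnA leq_pmulr ?muln_gt0 ?n_gt0.
  have : (n * n * n * n <= n * n * n * n * N)%N by rewrite leq_pmulr.
  lia.
have [[i0 i1 i2 i3] i4 iA hE] := va.
have [_ vecs _ _ _] := hE 0%N isT.
have lT r im' : locates im' (temp r) [:: 3; r]%N by [].
set x := nth 0 (Ls 0%N) j.
have lt_im0 : (im [:: 0%N] < 2 ^ N)%N by rewrite i0.
have lL := stored_locates v7.
apply: wp_seq.
apply: wp_mono (wp_pow n_gt0 i1 rp (lT 3%N) lL isT isT N_gt0 lt_im0) _ _ => // st1.
rewrite vecs // -/x i0 => -[im1 [mm1 [r1 x1 fi1 fm1]]].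
have va1 := valid_pow fi1 fm1 va.
have [[i10 i11 _ _] _ _ _] := va1.
have lt_im1 : (im1 [:: 0%N] < 2 ^ N)%N by rewrite i10.
apply: wp_seq.
apply: wp_mono (wp_pow n_gt0 i11 r1 (lT 4%N) (lT 3%N im1) isT isT N_gt0 lt_im1)
  _ _ => // st2.
rewrite x1 i10 => -[im2 [mm2 [r2 x2 fi2 fm2]]].
have va2 := valid_pow fi2 fm2 va1.
have [[_ i21 _ _] _ _ _] := va2.
apply: wp_seq.
apply: wp_mono (wp_msub n_gt0 i21 r2 (lT 0%N im2) (lT 4%N im2) (lT 3%N im2))
  _ _ => // st3.
rewrite x2 fm2 // x1 -/(frobdiff x) => r3.
have va3 := valid_mset 0 (frobdiff x) va2.
apply: wp_mono (wp_insert_valid (b := 1) isT r3 va3) _ _ => // st4.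
move=> [im4 [mm4 [l1 [r' [r4 va4 sp _ [fi4 fm4]]]]]].
exists im4, mm4, l1; split=> //.
by rewrite fi4 // fi2 // fi1.
Qed.

(** Family 0 is fixed from here on, so its counter is a constant loop bound, at most n^2. Here [N]
    bounds the bit length of [p]. *)
Lemma wp_frobenius im mm Ls st N :
  (p < 2 ^ N)%N -> rep im mm st -> valid im mm Ls -> Ls 1%N = [::] ->
  wp (For 7 (ICell (counter 0)) FrobeniusStep)
     (n * n * (n * n * n * n * N * 209 + 2) + 2) (fun st' => exists im' mm' l1,
    [/\ rep im' mm' st', valid im' mm' (fun c => if c == 1%N then l1 else Ls c) &
        <<l1>>%VS = <<[seq frobdiff x | x <- Ls 0%N]>>%VS]) st.
Proof.
move=> lt_p rp va l1; set ls := Ls 0%N.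
have [_ _ _ hE] := va; have [_ _ fr _ _] := hE 0%N isT.
pose I j st' := exists im' mm' l1,
    [/\ rep im' mm' st', valid im' mm' (fun c => if c == 1%N then l1 else Ls c),
        im' [:: 7%N] = j &
        <<l1>>%VS = <<[seq frobdiff x | x <- take j ls]>>%VS].
apply: (@wp_mono _ _ (size ls * (n * n * n * n * N * 209 + 2) + 2) _ (I (size ls))).
- apply: wp_for.
  + move=> j st' [im' [mm' [l1' [r' [_ _ _ /(_ 0%N isT)[c0 _ _ _ _]] v7 _]]]].
    by rewrite /= !r'.1.
  + exists (upd im [:: 7%N] 0%N), mm, [::]; split=> //.
    * exact: rep_iset.
    * have [h1 h2 h3 h4] := valid_iset 0 (isT : (3 < 7)%N) va; split=> // b b3.
      by case: eqP => [->|_]; [rewrite -l1; apply: h4 | apply: h4].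
    by rewrite take0.
  move=> j st' lt_j [im' [mm' [l1' [r' va' v7 sp]]]].
  apply: wp_mono (wp_frobenius_step lt_p r' va' v7 lt_j) _ _ => // st2.
  move=> [im2 [mm2 [l2 [r2 va2 v72 sp2]]]]; split; first by rewrite r2.1.
  exists (upd im2 [:: 7%N] j.+1), mm2, l2; split=> //.
  + exact: rep_iset.
  + have [h1 h2 h3 h4] := valid_iset j.+1 (isT : (3 < 7)%N) va2; split=> // b b3.
    by have := h4 b b3; case: eqP.
  rewrite sp2 /= sp (take_nth 0) // map_rcons -cats1 span_cat span_seq1.
  by [].
- by rewrite leq_add2r leq_mul2r free_size_le ?orbT.
move=> st' [im' [mm' [l1' [r' va' _ sp]]]]; exists im', mm', l1'; split=> //.
by rewrite sp take_size.
Qed.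

Lemma rep_input : rep
  (fun a => if a is [:: x] then nth 0%N [:: p; n; t; s] x else 0%N)
  (fun u => if u is [:: k] then if insub k is Some k' then tnth A k' else 0 else 0)
  (input s A).
Proof.
split=> // u i j.
have valKn (x : 'I_n) : insub (x : nat) = Some x by apply: valK.
case: u => [|k [|k' [|x [|y u]]]] //=; rewrite ?mxE // !valKn.
by case: insub => [k'|]; rewrite ?mxE.
Qed.

Lemma wp_decide im mm Ls st :
  rep im mm st -> valid im mm Ls ->
  wp Decide 2 (fun st' => accepting st' <->
    [/\ size (Ls 0%N) = s, size (Ls 2%N) = 0%N &
        (size (Ls 1%N)).+1 = size (Ls 0%N)]) st.
Proof.
move=> rp [[_ _ _ i3] i4 _ hE].
have [[c0 _ _ _ _] [c1 _ _ _ _] [c2 _ _ _ _]] :=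
  And3 (hE 0%N isT) (hE 1%N isT) (hE 2%N isT).
have gE : ieval (icell st) (IAdd (dist (ICell (counter 0)) (ivar 3))
       (IAdd (ICell (counter 2))
             (dist (IAdd (ICell (counter 1)) (ICst 1)) (ICell (counter 0))))) =
  (size (Ls 0%N) - s + (s - size (Ls 0%N)) + (size (Ls 2%N) +
   (size (Ls 1%N) + 1 - size (Ls 0%N) + (size (Ls 0%N) - (size (Ls 1%N) + 1)))))%N.
  by rewrite /= !rp.1 // c0 c1 c2 i3.
apply: wp_if; rewrite gE => h.
  apply: (wp_le (K := 0%N)) => //; apply: wp_skip.
  rewrite /accepting rp.1 // i4; split=> // -[h1 h2 h3]; lia.
by apply: wp_iset; rewrite /accepting; split=> // _; split; lia.
Qed.

Lemma wp_main N : (p < 2 ^ N)%N ->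
  wp Main (t * n ^ 6 * N * 500) (fun st' => accepting st' <->
    is_field gen /\ has_degree gen s) (input s A).
Proof.
move=> lt_p.
(* In order: writing the identity, inserting it, spinning, the images under phi^2 - phi, the final
   test. Every power of [n] is at most [t * n ^ 6 * N], and the coefficients add up to 416. *)
apply: (@wp_le _ (n * n * 11 + (n * n * n * n * 40 +
  (n * n * t * (n * n * n * n) * 150 +
  ((n * n * (n * n * n * n * N * 209 + 2) + 2) + 2))))).
- set im0 := fun a : seq nat => if a is [:: x] then nth 0%N [:: p; n; t; s] x else 0%N.
  set mm0 := fun u : seq nat => if u is [:: k] then
    if insub k is Some k' then tnth A k' else 0 else 0.
  have r0 : rep im0 mm0 (input s A) by exact: rep_input.
  have va0 : valid im0 mm0 (fun _ => [::]).
    split=> // [k|b b3]; first by rewrite /mm0 (valK k : insub (k : nat) = Some k).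
    split=> //; first by rewrite nil_free.
    move=> Z; rewrite span_nil memv0 => /eqP-> i j _ _; by rewrite mxE.
  have [[_ i1 _ _] _ _ _] := va0.
  have lX : locates im0 (temp 0) [:: 3; 0]%N by [].
  apply: wp_seq; apply: wp_mono (wp_ident n_gt0 i1 r0 lX) _ _ => // st1 r1.
  have va1 := valid_mset 0 1%:M va0.
  apply: wp_seq.
  apply: wp_mono (wp_insert_valid (b := 0) isT r1 va1) _ _ => // st2.
  move=> [im2 [mm2 [ls [r [r2 va2 sp _ _]]]]].
  rewrite span_nil add0v in sp.
  have {}sp : <<ls>>%VS = <[1%:M : 'M['F_p]_n]>%VS by rewrite sp /upd eqxx.
  apply: wp_seq; apply: wp_mono (wp_spin r2 va2 _ _) _ _ => //=.
    (* At the start family 0 spans the scalars, and no pair has been processed. *)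
    split.
    - move=> x /memv_span; rewrite sp => /vlineP [c ->].
      by apply/genZ/gen1.
    - by rewrite sp memv_line.
    - by move=> k a _; rewrite andbF orbF.
    by move=> _; rewrite span_nil.
  move=> st3 [im3 [mm3 [Ls [r3 va3 l1 [hg h1 hM h0]]]]].
  apply: wp_seq; apply: wp_mono (wp_frobenius lt_p r3 va3 l1) _ _ => // st4.
  move=> [im4 [mm4 [l1' [r4 va4 sp1]]]].
  apply: wp_mono (wp_decide r4 va4) _ _ => //= st5 ->.
  have [_ _ _ hE] := va4.
  have [[_ _ f0 _ _] [_ _ f1 _ _] [_ _ f2 _ _]] :=
    And3 (hE 0%N isT) (hE 1%N isT) (hE 2%N isT).
  apply: (field_criterion _ p_pr n_gt0) => //.
    move=> x a /(nthP 0)[k lt_k <-] /tnthP[i ->].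
    by case: (hM k i lt_k) => //; rewrite lt_k.
  move=> x a /(nthP 0)[k lt_k <-] /tnthP[i ->].
  by case: (hM k i lt_k) => //; rewrite lt_k.
have N_gt0 : (0 < N)%N.
  by case: N lt_p => // lt_p1; have := prime_gt0 p_pr; rewrite lt0n; case: p lt_p1.
have powle a : (a <= 6)%N -> (n ^ a <= t * n ^ 6 * N)%N.
  move=> a6; apply: (@leq_trans (n ^ 6)); first by rewrite leq_pexp2l.
  by rewrite mulnAC leq_pmull // muln_gt0 t_gt0.
have e2 : (n * n = n ^ 2)%N by [].
have e4 : (n * n * n * n = n ^ 4)%N by rewrite !expnS expn0; lia.
have e6 : (n * n * t * (n * n * n * n) = t * n ^ 6)%N by rewrite !expnS expn0; lia.
have e6' : (n * n * (n * n * n * n * N * 209 + 2) = n ^ 6 * N * 209 + n ^ 2 * 2)%N.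
  by rewrite !expnS expn0; lia.
rewrite e6 e6' e4 e2.
have := powle 2%N isT; have := powle 4%N isT; have := powle 0%N isT.
have : (t * n ^ 6 <= t * n ^ 6 * N)%N by rewrite leq_pmulr.
have : (n ^ 6 * N <= t * n ^ 6 * N)%N by rewrite leq_mul2r leq_pmull ?orbT.
rewrite expn0; move: (n ^ 6 * N)%N (t * n ^ 6 * N)%N => u v.
lia.
Qed.

End Main.

(** * From bit length to the natural logarithm *)

(** As [p] is at least 2, both 1 and the truncated binary logarithm are at most [ln p / ln 2]; this
    is where the factor 2 comes from. *)
Lemma trunc_log2_le_ln (R : realType) p : (1 < p)%N ->
  ((trunc_log 2 p).+1%:R : R) <= 2 / ln 2 * ln p%:R.
Proof.
move=> lt1p; have ln2 : 0 < ln 2 :> R by rewrite ln_gt0 // ltr1n.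
have lnX k : (2 ^ k <= p)%N -> k%:R * ln 2 <= ln p%:R :> R.
  move=> le_p; rewrite mulr_natl -lnXn ?ltr0n // ler_ln ?posrE ?exprn_gt0 ?ltr0n //.
    by rewrite -natrX ler_nat.
  exact: ltnW.
have h1 := lnX 1%N lt1p.
have h2 := lnX _ (trunc_logP (isT : (1 < 2)%N) (ltnW lt1p)).
rewrite mulrAC ler_pdivlMr // -natr1 mulrDl [2 * _]mulr_natl mulr2n.
exact: lerD.
Qed.

Unset Implicit Arguments.

Theorem theorem1 (R : realType) :
  exists (prog : cmd) (C : R),
  forall (p n t s : nat) (A : t.-tuple 'M['F_p]_n),
    prime p -> (0 < n)%N -> (0 < t)%N -> (0 < s)%N ->
    (forall M, M \in A -> M \in unitmx) ->
    exists (k m : nat) (st : state 'F_p),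
      [/\ exec prog (input s A) k m st,
          accepting st <->
            is_field (gen_algebra (mem A)) /\
            has_degree (gen_algebra (mem A)) s,
          k%:R <= C * (t%:R * n%:R ^+ 6 * ln p%:R)
        & m%:R <= C * (t%:R * n%:R ^+ 6 * ln p%:R)].
Proof.
(* The factor 500 is that of [wp_main]; [2 / ln 2] converts the bit length of [p] into [ln p]. *)
exists Main, (500 * (2 / ln 2)) => p n t s A p_pr n_gt0 t_gt0 _ _.
have lt_p : (p < 2 ^ (trunc_log 2 p).+1)%N by apply: trunc_log_ltn.
have [k [m [st [E le_km acc]]]] := wp_main s A p_pr n_gt0 t_gt0 lt_p.
exists k, m, st.
suff le_K x : (x <= k + m)%N ->
    x%:R <= 500 * (2 / ln 2) * (t%:R * n%:R ^+ 6 * ln p%:R) :> R.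
  by split=> //; apply: le_K; rewrite ?leq_addr ?leq_addl.
move=> le_x; have {le_x}le_x := leq_trans le_x le_km.
apply: (@le_trans _ _ (t * n ^ 6 * (trunc_log 2 p).+1 * 500)%:R).
  by rewrite ler_nat.
rewrite 3!natrM natrX [leLHS]mulrC -[leRHS]mulrA ler_wpM2l // [leRHS]mulrCA.
apply: ler_wpM2l; first by rewrite mulr_ge0 ?exprn_ge0.
exact/trunc_log2_le_ln/prime_gt1.
Qed.
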